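(* Let $f\colon B^*\to B^*$ be a morphism prolongable on a letter $a\in B$ and let $g\colon B^*\to A^*$ be a morphism such that $g(f^\omega(a))$ is an infinite word. Let $p=\mathsf{p}(\mathsf{Mat}_f)$, let $B'=\{b\in B\mid g(f^{pn}(b))\neq\varepsilon\ \text{for all large enough } n\}$, and let $f'\colon B'^*\to B'^*$ be the restriction of $\kappa_{B,B\setminus B'}\circ f^p$ to $B'^*$. Then $f^p(B\setminus B')\subseteq (B\setminus B')^*$, so that the restriction $f^p_{B\setminus B'}\colon(B\setminus B')^*\to(B\setminus B')^*$ of $f^p$ is a sub-morphism of $f^p$. Moreover, if $f$ has growth type $(\lambda,d)$ with respect to $a$, then exactly one of the following situations occurs: 1. $\lambda^p\notin\mathrm{Spec}(f^p_{B\setminus B'})$ and $f'$ has growth type $(\lambda^p,d)$ with respect to $a$; 2. $\lambda^p\in\mathrm{Spec}(f^p_{B\setminus B'})$ and $\lambda^p\notin\mathrm{Spec}(f')$ and there exist $\lambda'\in\mathrm{Spec}(f)$ and $d'\in\mathbb{N}$ such that $\lambda'<\lambda$ and $f'$ has growth type $(\lambda'^p,d')$ with respect to $a$; 3. $\lambda^p\in\mathrm{Spec}(f^p_{B\setminus B'})$ and $\lambda^p\in\mathrm{Spec}(f')$ and $f'$ has growth type $(\lambda^p,d')$ with respect to $a$ for some $d'\le d$.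
   Context: Alphabets are finite; $A^*$ is the free monoid of finite words over $A$, with empty word $\varepsilon$, and $A^+=A^*\setminus\{\varepsilon\}$. $|w|$ is the length of $w$ and $|w|_a$ the number of occurrences of the letter $a$ in $w$. Morphisms are monoid morphisms, extended letterwise to infinite words. A morphism $f\colon B^*\to B^*$ is prolongable on $a\in B$ if $f(a)=au$ for some $u\in B^+$ and $|f^n(a)|\to+\infty$; then $f^\omega(a)=\lim_{n\to\infty}f^n(a)$ denotes the infinite word having all $f^n(a)$ as prefixes. The incidence matrix $\mathsf{Mat}_f\in\mathbb{N}^{B\times B}$ of $f\colon B^*\to B^*$ is defined by $(\mathsf{Mat}_f)_{b,c}=|f(c)|_b$; $\mathrm{Spec}(f)$ denotes the multiset of (complex) eigenvalues of $\mathsf{Mat}_f$ (empty if the alphabet is empty). For $C\subseteq B$, $\kappa_{B,C}\colon B^*\to(B\setminus C)^*$ is the morphism with $\kappa_{B,C}(b)=\varepsilon$ if $b\in C$ and $\kappa_{B,C}(b)=b$ otherwise. If $h\colon B^*\to B^*$ is a morphism and $C\subseteq B$ satisfies $h(C)\subseteq C^*$, the restriction of $h$ to $C^*$ is called a sub-morphism of $h$ and denoted $h_C$. A non-negative square matrix $P$ is primitive if some power $P^k$, $k\ge1$, has only positive entries. For a non-negative square matrix $M$, $\mathsf{p}(M)$ denotes the least positive integer $p$ for which there exists a permutation matrix $T$ such that $T^{-1}M^pT$ is an upper (or lower) block triangular matrix in which each square diagonal block is either primitive or the $1\times1$ zero matrix (such a $p$ always exists). Growth type: a morphism $f\colon B^*\to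 B^*$ prolongable on $a$ has growth type $(\lambda,d)$ with respect to $a$ (with $\lambda\geq 1$ real, $d\in\mathbb{N}$) if all letters of $B$ occur in $f^\omega(a)$ and $|f^n(a)|=\Theta(n^d\lambda^n)$, i.e. there are constants $c,C>0$ with $c\,n^d\lambda^n\le|f^n(a)|\le C\,n^d\lambda^n$ for all large $n$. *)

(* Defs.v *)
(* [boolp] serves only to turn a proposition into a boolean in [survivors]. *)
From mathcomp Require Import all_boot all_order all_algebra all_fingroup.
From mathcomp Require Import boolp reals.
From mathcomp Require Import complex.

Set Implicit Arguments.
Unset Strict Implicit.
Unset Printing Implicit Defensive.

Import Order.TTheory GRing.Theory Num.Theory.

(* A morphism B^* -> A^* is given by the images of the letters, f : B -> seq A;
   [mext f] is the monoid morphism it determines.  Infinite words are functions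
   nat -> B. *)
Section Morphisms.

Definition mext (B A : Type) (f : B -> seq A) (w : seq B) : seq A :=
  flatten (map f w).

Definition mcomp (D B A : Type) (g : B -> seq A) (f : D -> seq B) : D -> seq A :=
  fun b => mext g (f b).

Definition mpow (B : Type) (f : B -> seq B) (n : nat) : B -> seq B :=
  fun b => iter n (mext f) [:: b].

Definition prolongable (B : Type) (f : B -> seq B) (a : B) : Prop :=
  (exists u : seq B, u <> [::] /\ f a = a :: u) /\
  (forall M : nat, exists N : nat, forall n : nat,
     N <= n -> M <= size (mpow f n a)).

(* If f is prolongable on a then size (mpow f i a) > i and all the words
   mpow f n a are prefixes of omega_word f a; see [omega_wordP]. *)
Definition omega_word (B : Type) (f : B -> seq B) (a : B) : nat -> B :=
  fun i => nth a (mpow f i a) i.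

Definition infinite_image (B A : Type) (g : B -> seq A) (w : nat -> B) : Prop :=
  forall M : nat, exists n : nat, M <= size (mext g (mkseq w n)).

Definition kappa (B : finType) (C : {set B}) : B -> seq B :=
  fun b => if b \in C then [::] else [:: b].

(* Restriction of h to the alphabet C; meaningful when the images of the letters
   of C are words over C, in which case [pmap insub] drops no letter; see
   [sub_morphismP]. *)
Definition sub_morphism (B : finType) (h : B -> seq B) (C : {set B}) :
    {b : B | b \in C} -> seq {b : B | b \in C} :=
  fun b => pmap insub (h (val b)).

Definition survivors (B A : finType) (f : B -> seq B) (g : B -> seq A)
    (p : nat) : {set B} :=
  [set b : B | `[< exists N : nat, forall n : nat,
                     N <= n -> mext g (mpow f (p * n) b) <> [::] >]].

Lemma mext_cat (B A : Type) (f : B -> seq A) u v :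
  mext f (u ++ v) = mext f u ++ mext f v.
Proof. by rewrite /mext map_cat flatten_cat. Qed.

Lemma omega_wordP (B : Type) (f : B -> seq B) (a : B) (n : nat) :
  prolongable f a ->
  mpow f n a = mkseq (omega_word f a) (size (mpow f n a)).
Proof.
move=> [[u [_ fa]] finf].
pose v k := iter k (mext f) u.
have iter_nil m : iter m (mext f) [::] = [::] by elim: m => //= m ->.
have iter_cat m x y :
    iter m (mext f) (x ++ y) = iter m (mext f) x ++ iter m (mext f) y.
  by elim: m => //= m ->; rewrite mext_cat.
have powS m : mpow f m.+1 a = mpow f m a ++ v m.
  by rewrite /mpow iterSr /= /mext /= fa cats0 -cat1s iter_cat.
have pow_add m k : exists w, mpow f (m + k) a = mpow f m a ++ w.
  elim: k => [|k [w Ew]]; first by exists [::]; rewrite addn0 cats0.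
  by exists (w ++ v (m + k)); rewrite addnS powS Ew catA.
have v_n0 k : 0 < size (v k).
  rewrite lt0n; apply/negP => /nilP vk0.
  have vz j : v (k + j) = [::] by rewrite /v addnC iterD -/(v k) vk0 iter_nil.
  have stat j : mpow f (k + j) a = mpow f k a.
    by elim: j => [|j IH]; rewrite ?addn0 // addnS powS vz cats0.
  have [N /(_ (k + N) (leq_addl _ _))] := finf (size (mpow f k a)).+1.
  by rewrite stat ltnn.
have size_pow i : i < size (mpow f i a).
  by elim: i => // i IH; rewrite powS size_cat -addn1; apply: leq_add.
apply: (@eq_from_nth _ a); first by rewrite size_mkseq.
move=> i lt_i; rewrite nth_mkseq // /omega_word.
have [w Ew] := pow_add n i; have [w' Ew'] := pow_add i n.
have: nth a (mpow f (n + i) a) i = nth a (mpow f (i + n) a) i by rewrite addnC.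
by rewrite Ew Ew' !nth_cat lt_i size_pow.
Qed.

Lemma sub_morphismP (B : finType) (h : B -> seq B) (C : {set B})
    (b : {b : B | b \in C}) :
  {subset h (val b) <= C} -> map val (@sub_morphism B h C b) = h (val b).
Proof.
move=> hC; rewrite /sub_morphism pmap_filter; last exact: insubK.
by apply/all_filterP/allP => c /hC cC; rewrite /= insubT.
Qed.

Lemma kappa_closed (B : finType) (h : B -> seq B) (C : {set B}) (b : B) :
  {subset mcomp (kappa (~: C)) h b <= C}.
Proof.
move=> c /flattenP [s /mapP [d _ ->]]; rewrite /kappa inE.
by case: ifP => // /negbFE dC; rewrite inE => /eqP ->.
Qed.

End Morphisms.

Section Matrices.

Local Open Scope ring_scope.

(* Rows and columns are indexed by the letters through [enum_val]. *)
Definition incidence (B : finType) (f : B -> seq B) : 'M[nat]_#|B| :=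
  \matrix_(i, j) count_mem (enum_val i) (f (enum_val j)).

Definition primitive_mx n (P : 'M[nat]_n) : Prop :=
  exists k : nat, (0 < k)%N /\ forall i j, (0 < (P ^+ k) i j)%N.

Definition primitive_block_triangular n (N : 'M[nat]_n) : Prop :=
  exists (k : nat) (q : 'I_k -> nat) (E : n = (\sum_(i < k) q i)%N),
    let N' := castmx (E, E) N in
    [/\ forall i, (0 < q i)%N,
        (forall i j : 'I_k, (j < i)%N -> submxblock N' i j = 0) \/
        (forall i j : 'I_k, (i < j)%N -> submxblock N' i j = 0)
      & forall i, primitive_mx (submxblock N' i i) \/
                  (q i = 1%N /\ submxblock N' i i = 0)].

(* perm_mx s^-1 is the inverse of the permutation matrix perm_mx s. *)
Definition primitive_power n (M : 'M[nat]_n) (p : nat) : Prop :=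
  exists s : 'S_n,
    primitive_block_triangular (perm_mx s^-1 *m (M ^+ p) *m perm_mx s).

Definition is_primitive_period n (M : 'M[nat]_n) (p : nat) : Prop :=
  [/\ (0 < p)%N, primitive_power M p
    & forall q : nat, (0 < q)%N -> primitive_power M q -> (p <= q)%N].

(* Only membership in the spectrum is needed, so multiplicities are omitted. *)
Definition Spec (R : realType) (B : finType) (f : B -> seq B) : pred R[i] :=
  [pred z | eigenvalue (map_mx (fun m : nat => m%:R : R[i]) (incidence f)) z].

Definition growth_type (R : realType) (B : Type) (f : B -> seq B) (a : B)
    (lam : R) (d : nat) : Prop :=
  [/\ 1 <= lam, prolongable f a,
      forall b : B, exists i : nat, omega_word f a i = b
    & exists c C : R, [/\ 0 < c, 0 < C
        & exists N : nat, forall n : nat, (N <= n)%N ->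
            c * (n%:R ^+ d * lam ^+ n) <= (size (mpow f n a))%:R /\
            (size (mpow f n a))%:R <= C * (n%:R ^+ d * lam ^+ n)]].

(* Growth type with respect to the letter a of the larger alphabet B; it
   entails that a belongs to the sub-alphabet C. *)
Definition sub_growth_type (R : realType) (B : finType) (C : {set B})
    (h : {b : B | b \in C} -> seq {b : B | b \in C}) (a : B)
    (lam : R) (d : nat) : Prop :=
  exists aC : a \in C, growth_type h (exist _ a aC) lam d.

End Matrices.

Arguments Spec R {B} f.

Definition exactly_one3 (P Q S : Prop) : Prop :=
  [\/ [/\ P, ~ Q & ~ S], [/\ ~ P, Q & ~ S] | [/\ ~ P, ~ Q & S]].

(* Main.v *)
(* Everything is governed by nonnegative functionals x on letters, extended
   additively to words, that satisfy x(f(b)) = z x(b): these are the left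
   eigenvectors of the incidence matrix, and |f^n(b)| dominates z^n x(b).
   A weak Perron theorem for an arbitrary nonnegative matrix provides such an x
   for some r together with, for every t > r, a positive y with y M <= t y, which
   bounds all lengths by O(t^n).  Hence the exponential rate of |f^n(a)|, when
   all letters are accessible from a, is the largest real eigenvalue and has a
   nonnegative eigenfunctional.
   Along strongly connected classes the lengths obey scalar recurrences
   s(n+1) = r s(n) + e(n), so that |f'^n(a)| is Theta(n^d' mu^n) for some mu, d',
   and (mu, d') is at most (lam^p, d) lexicographically.  The blocks of
   Mat_f^p being primitive, the set of letters of f^(pn)(b) is ultimately
   constant, so that a letter outside B' is erased by all large powers; this
   makes f' non-erasing and prolongable.
   The three cases compare mu with lam^p.  If lam^p is not an eigenvalue on
   B \ B', lengths there are O(t^n) with t < lam^p, so the whole growth of f^p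
   is carried by f' and (mu, d') = (lam^p, d).  If mu < lam^p, the
   eigenfunctional of f' for mu, extended by 0, is one of f^p, and averaging it
   along f yields an eigenvalue mu^(1/p) of f. *)
Require Import Defs.
From mathcomp Require Import all_boot all_order all_algebra.
From mathcomp Require Import fingroup perm reals complex.
From mathcomp Require Import boolp classical_sets topology normedtype derive.
From mathcomp Require Import ring lra.

Set Implicit Arguments.
Unset Strict Implicit.
Unset Printing Implicit Defensive.

Import Order.TTheory GRing.Theory Num.Theory.
Import numFieldNormedType.Exports.
Local Open Scope ring_scope.
Local Open Scope complex_scope.

(** * A weak Perron theorem *)

Section Perron.
Variable R : realType.
Implicit Types (n : nat) (r t : R).

(** By compactness: the continuous defect [phi] attains its minimum on the cube [K], and approximate
    eigenvectors force this minimum to be 0. Penalising [\sum_j x 0 j - 1] inside [phi] allows the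
    compact set to be a product of segments. *)
Lemma approx_eigenvector_simplex n (M : 'M[R]_n) r :
  (forall e : R, 0 < e -> exists x : 'rV[R]_n,
     [/\ forall j, 0 <= x 0 j, \sum_j x 0 j = 1
       & forall j, `|(x *m M) 0 j - r * x 0 j| <= e]) ->
  exists x : 'rV[R]_n,
    [/\ forall j, 0 <= x 0 j, \sum_j x 0 j = 1 & x *m M = r *: x].
Proof.
move=> approx.
pose phi (x : 'rV[R]_n) : R :=
  \sum_j `|(x *m M) 0 j - r * x 0 j| + `|\sum_j x 0 j - 1|.
pose K : set 'rV[R]_n := [set x | forall j, 0 <= x 0 j <= 1]%classic.
have le1 (x : 'rV[R]_n) : (forall j, 0 <= x 0 j) -> \sum_j x 0 j = 1 -> K x.
  move=> x0 x1 j; rewrite x0 -x1 (bigD1 j) //= lerDl.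
  by apply: sumr_ge0.
have cK : compact K.
  rewrite (_ : K = [set x | forall j, `[0%R:R, 1%R] (x ord0 j)]%classic).
    by apply: (@rV_compact R n (fun=> `[0, 1]%classic)) => _;
      apply: (@segment_compact R 0 1).
  by apply/seteqP; split=> x Kx j /=; have := Kx j; rewrite /= in_itv.
have K0 : (K !=set0)%classic.
  by have [x [x0 x1 _]] := approx 1 ltr01; exists x; apply: le1.
have cphi : continuous phi.
  have cc j : continuous (fun x : 'rV[R]_n => x 0 j) by apply: coord_continuous.
  have csum (F : 'I_n -> 'rV[R]_n -> R) :
      (forall i, continuous (F i)) -> continuous (fun x => \sum_i F i x).
    move=> cF; have := @continuous_big R 'I_n +%R 0 xpredT (@add_continuous R)
      'rV[R]_n (index_enum _) F.
    by apply.
  have cst (k : R) : continuous (fun _ : 'rV[R]_n => k) by exact: cst_continuous.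
  have cmul (u v : 'rV[R]_n -> R) : continuous u -> continuous v ->
    continuous (fun x => u x * v x) by move=> cu cv x; exact: cvgM (cu x) (cv x).
  have cabsB (u v : 'rV[R]_n -> R) : continuous u -> continuous v ->
      continuous (fun x => `|u x - v x|).
    by move=> cu cv x; exact: cvg_norm (cvgB (cu x) (cv x)).
  have cM j : continuous (fun x : 'rV[R]_n => (x *m M) 0 j).
    have -> : (fun y : 'rV[R]_n => (y *m M) 0 j) =
              (fun y => \sum_i y 0 i * M i j) by apply: funext => y; rewrite mxE.
    exact: csum (fun i => cmul _ _ (cc i) (cst _)).
  have c1 := csum _ (fun j => cabsB _ _ (cM j) (cmul _ _ (cst r) (cc j))).
  have c2 := cabsB _ _ (csum _ cc) (cst 1).
  by move=> x; exact: cvgD (c1 x) (c2 x).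
have [x] := compact_EVT_min K0 cK (continuous_subspaceT cphi).
rewrite inE => Kx minx.
have phi0 : phi x <= 0.
  apply/ler_addgt0Pr => e e0; rewrite add0r.
  have n1 : 0 < n%:R + 1 :> R by rewrite ltr_wpDl.
  have [y [y0 y1 ye]] := approx (e / (n%:R + 1)) (divr_gt0 e0 n1).
  apply: (le_trans (minx y _)); first by rewrite inE; apply: le1.
  rewrite /phi y1 subrr normr0 addr0.
  apply: (@le_trans _ _ (\sum_(j < n) e / (n%:R + 1))); first exact: ler_sum.
  rewrite sumr_const card_ord -[leLHS]mulr_natl mulrCA ger_pMr //.
  by rewrite ler_pdivrMr // mul1r lerDl.
move: phi0; rewrite /phi => phi0.
have s0 : \sum_j `|(x *m M) 0 j - r * x 0 j| = 0.
  apply/eqP; rewrite eq_le sumr_ge0 // andbT.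
  by apply: le_trans phi0; rewrite lerDl.
exists x; split=> [j||].
- by have /andP[] := Kx j.
- by apply/eqP; rewrite -subr_eq0 -normr_le0; move: phi0; rewrite s0 add0r.
apply/rowP => j; rewrite [RHS]mxE; apply/eqP; rewrite -subr_eq0 -normr_eq0.
by move/eqP: s0; rewrite psumr_eq0 // => /allP/(_ j (mem_index_enum j))/implyP; apply.
Qed.


(** A minimum principle: thanks to the positive supersolution [y], [z *m M <= t z] implies [z >= 0].
    Applied to [z] and [- z], this makes [t%:M - M] injective; applied to the solution of the
    equation, it gives its sign. *)
Lemma exact_resolvent_row n (M : 'M[R]_n) t (y : 'rV[R]_n) :
  (forall i j, 0 <= M i j) -> (forall j, 0 < y 0 j) ->
  (forall j, (y *m M) 0 j + 1 <= t * y 0 j) ->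
  exists z : 'rV[R]_n, (forall j, 0 <= z 0 j) /\
    forall j, (z *m M) 0 j + 1 = t * z 0 j.
Proof.
move=> M0 y0 yM.
have mono (z : 'rV[R]_n) :
    (forall j, (z *m M) 0 j <= t * z 0 j) -> forall j, 0 <= z 0 j.
  move=> zM j; rewrite leNgt; apply/negP => zj.
  (* at an index minimising z / y, z + c y vanishes *)
  have [i _ /= imin] := @Order.TotalTheory.arg_minP _ _ _ j xpredT
    (fun k => z 0 k / y 0 k) isT.
  pose c := - (z 0 i / y 0 i).
  have c0 : 0 < c.
    rewrite oppr_gt0; apply: (le_lt_trans (imin j isT)).
    by rewrite ltr_pdivrMr // mul0r.
  have w0 k : 0 <= z 0 k + c * y 0 k.
    rewrite /c mulNr subr_ge0 -ler_pdivlMr //; exact: imin.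
  have wi : z 0 i + c * y 0 i = 0 by rewrite /c mulNr divfK ?subrr // gt_eqF.
  have : 0 <= ((z + c *: y) *m M) 0 i.
    by rewrite mxE; apply: sumr_ge0 => k _; rewrite !mxE mulr_ge0.
  have -> : ((z + c *: y) *m M) 0 i = (z *m M) 0 i + c * (y *m M) 0 i.
    by rewrite mulmxDl -scalemxAl !mxE.
  have := zM i; have := yM i; move: wi c0.
  set zi := z 0 i; set yi := y 0 i; set zm := (z *m M) 0 i; set ym := (y *m M) 0 i.
  move=> wi c0 h1 h2 h3.
  have : c * (ym + 1) <= c * (t * yi) by rewrite ler_pM2l.
  have -> : c * (t * yi) = - (t * zi) by rewrite mulrCA -mulrN; congr (_ * _); lra.
  by lra.
pose A := t%:M - M.
have AE (z : 'rV[R]_n) j : (z *m A) 0 j = t * z 0 j - (z *m M) 0 j.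
  by rewrite /A mulmxBr mul_mx_scalar !mxE.
have uA : A \in unitmx.
  rewrite -row_free_unit; apply: inj_row_free => z zA.
  have zE j : (z *m M) 0 j = t * z 0 j.
    by apply/esym/eqP; rewrite -subr_eq0 -AE zA mxE.
  have zN k : ((- z) *m M) 0 k <= t * (- z) 0 k.
    by rewrite mulNmx mxE [X in _ <= _ * X]mxE zE mulrN.
  apply/rowP => j; rewrite [RHS]mxE; apply/eqP; rewrite eq_le.
  apply/andP; split; last by apply: mono => k; rewrite zE.
  by have := mono _ zN j; rewrite mxE oppr_ge0.
pose z : 'rV[R]_n := const_mx 1 *m invmx A.
have zM j : (z *m M) 0 j + 1 = t * z 0 j.
  have : (z *m A) 0 j = 1 by rewrite /z mulmxKV // mxE.
  by rewrite AE => <-; ring.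
exists z; split=> //; apply: mono => j; by rewrite -zM lerDl.
Qed.

(** [r] is the infimum of the [t] for which [y *m M + 1 <= t y] has a nonnegative solution. If
    [0 < r], exact solutions blow up as [t] tends to [r], and once normalised they are approximate
    eigenvectors. The eigenvector is conditional on [0 < r]: for [n = 0] the infimum is 0 and no
    nonzero row exists. *)
Lemma perron_row n (M : 'M[R]_n) :
  (forall i j, 0 <= M i j) ->
  exists r, [/\ 0 <= r,
    0 < r -> exists x : 'rV[R]_n,
      [/\ forall j, 0 <= x 0 j, exists j, 0 < x 0 j & x *m M = r *: x]
    & forall t, r < t -> exists y : 'rV[R]_n,
      (forall j, 0 < y 0 j) /\ forall j, (y *m M) 0 j <= t * y 0 j].
Proof.
move=> M0.
have yM0 (y : 'rV[R]_n) j : (forall j, 0 <= y 0 j) -> 0 <= (y *m M) 0 j.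
  by move=> y0; rewrite mxE sumr_ge0 // => i _; rewrite mulr_ge0.
pose G : set R := [set t | 0 < t /\ exists y : 'rV[R]_n,
  (forall j, 0 <= y 0 j) /\ forall j, (y *m M) 0 j + 1 <= t * y 0 j]%classic.
have Gpos t (y : 'rV[R]_n) : 0 < t -> (forall j, 0 <= y 0 j) ->
    (forall j, (y *m M) 0 j + 1 <= t * y 0 j) -> forall j, 0 < y 0 j.
  move=> t0 y0 yM j; rewrite -(pmulr_rgt0 _ t0).
  by apply: lt_le_trans (yM j); rewrite ltr_wpDl ?yM0.
have G0 : (G !=set0)%classic.
  exists (1 + \sum_i \sum_j M i j); split.
    by rewrite ltr_pwDl // sumr_ge0 // => i _; rewrite sumr_ge0.
  exists (const_mx 1); split=> j; rewrite !mxE //.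
  rewrite addrC mulr1 lerD2l; apply: ler_sum => i _; rewrite mxE mul1r.
  by rewrite (bigD1 j) //= lerDl sumr_ge0.
have lbG : lbound G 0 by move=> t [/ltW].
have infG : has_inf G by split=> //; exists 0.
pose r := inf G.
have r0 : 0 <= r by apply: lb_le_inf.
have rG t : G t -> r <= t by move=> Gt; apply: ge_inf => //; exists 0.
have adh e : 0 < e -> exists2 t, G t & t < r + e by move=> e0; apply: inf_adherent.
(* If [r] were in [G], so would be some smaller number: doubling [y] leaves a slack of 1 in each
   coordinate, and lowering [r] by [e] uses [2 * (e * y 0 j) <= 1] of it. *)
have rNG : 0 < r -> ~ G r.
  move=> rpos [_ [y [y0 yM]]].
  pose K : R := 1 + \sum_j y 0 j.
  have yK j : y 0 j <= K.
    by rewrite /K (bigD1 j) //= addrCA lerDl addr_ge0 // sumr_ge0.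
  have K0 : 0 < K by rewrite ltr_pwDl // sumr_ge0.
  pose e := Num.min (r / 2) (2 * K)^-1.
  have e0 : 0 < e by rewrite lt_min; apply/andP; split; [lra|rewrite invr_gt0; lra].
  have e1 : e <= r / 2 by rewrite ge_min lexx.
  have eK j : 2 * (e * y 0 j) <= 1.
    apply: (@le_trans _ _ (2 * ((2 * K)^-1 * K))).
      rewrite ler_pM2l //; apply: ler_pM => //; first exact: ltW.
      by rewrite ge_min lexx orbT.
    by rewrite le_eqVlt; apply/orP; left; apply/eqP; field; rewrite gt_eqF.
  suff : G (r - e) by move/rG; lra.
  split; first by lra.
  exists (2 *: y); split=> j; first by rewrite mxE mulr_ge0.
  rewrite -scalemxAl mxE [X in _ <= _ * X]mxE.
  by have := yM j; have := eK j; set a := (y *m M) 0 j; set b := y 0 j; lra.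
exists r; split=> // [rpos|t rt].
  have [|x [x0 x1 xM]] := @approx_eigenvector_simplex n M r; last first.
    exists x; split=> //; apply: contrapT => nx.
    have : \sum_j x 0 j = 0.
      apply: big1 => j _; apply/eqP; rewrite eq_le x0 andbT leNgt.
      by apply/negP => xj; apply: nx; exists j.
    by rewrite x1 => /eqP; rewrite oner_eq0.
  move=> e e0.
  have e3 : 0 < e / 3 by lra.
  have [t Gt te] := adh _ e3.
  have rt : r < t.
    by rewrite lt_neqAle rG // andbT; apply/eqP => rt; apply: (rNG rpos); rewrite rt.
  have t0 := lt_trans rpos rt.
  case: (Gt) => _ [y' [y'0 y'M]].
  have [y [y0 yM]] := exact_resolvent_row M0 (Gpos _ _ t0 y'0 y'M) y'M.
  (* Otherwise [2 *: y] would witness [G r]. Hence the sum [s] exceeds [1 / (2 (t - r))], and the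
     normalised row has defect [(t - r) x_j - 1 / s], small with [t - r]. *)
  have [i yi] : exists i, 1 < 2 * (t - r) * y 0 i.
    apply: contrapT => ny; apply: (rNG rpos); split=> //.
    exists (2 *: y); split=> j; first by rewrite mxE mulr_ge0.
    have : 2 * (t - r) * y 0 j <= 1.
      by rewrite leNgt; apply/negP => yj; apply: ny; exists j.
    rewrite -scalemxAl mxE [X in _ <= _ * X]mxE.
    by have := yM j; set a := (y *m M) 0 j; set b := y 0 j; lra.
  pose s := \sum_j y 0 j.
  have sge j : y 0 j <= s by rewrite /s (bigD1 j) //= lerDl sumr_ge0.
  have yi0 : 0 < y 0 i.
    rewrite -(@pmulr_rgt0 _ (2 * (t - r))); last by lra.
    exact: lt_trans yi.
  have s0 : 0 < s by apply: lt_le_trans (sge i).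
  have is0 : s^-1 < 2 * (t - r).
    rewrite -div1r ltr_pdivrMr //; apply: lt_le_trans yi _.
    by rewrite ler_pM2l //; lra.
  exists (s^-1 *: y); split=> [j||j].
  - by rewrite mxE mulr_ge0 // invr_ge0 ltW.
  - under eq_bigr do rewrite mxE.
    by rewrite -mulr_sumr mulVf // gt_eqF.
  rewrite -scalemxAl mxE [X in _ - _ * X]mxE.
  have -> : (y *m M) 0 j = t * y 0 j - 1 by rewrite -yM addrK.
  have -> : s^-1 * (t * y 0 j - 1) - r * (s^-1 * y 0 j)
          = (t - r) * (s^-1 * y 0 j) - s^-1 by ring.
  have b1 : s^-1 * y 0 j <= 1 by rewrite mulrC ler_pdivrMr // mul1r.
  have b0 : 0 <= s^-1 * y 0 j by rewrite mulr_ge0 // invr_ge0 ltW.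
  have b2 : (t - r) * (s^-1 * y 0 j) <= t - r.
    by rewrite -[leRHS]mulr1 ler_pM2l // subr_gt0.
  have b3 : 0 <= (t - r) * (s^-1 * y 0 j) by rewrite mulr_ge0 // subr_ge0 ltW.
  have b4 : 0 < s^-1 by rewrite invr_gt0.
  by rewrite ler_norml; apply/andP; split; lra.
have d0 : 0 < t - r by rewrite subr_gt0.
have [t' [t'0 [y [y0 yM]]] t't] := adh _ d0.
exists y; split; first exact: Gpos yM.
move=> j; apply: (@le_trans _ _ (t' * y 0 j)); last by rewrite ler_wpM2r //; lra.
by apply: le_trans (yM j); rewrite lerDl.
Qed.

Lemma perron_fun (T : finType) (M : T -> T -> R) :
  (forall c b, 0 <= M c b) ->
  exists r, [/\ 0 <= r,
    0 < r -> exists x : T -> R,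
      [/\ forall b, 0 <= x b, exists b, 0 < x b
        & forall b, \sum_c x c * M c b = r * x b]
    & forall t, r < t -> exists y : T -> R,
      (forall b, 0 < y b) /\ forall b, \sum_c y c * M c b <= t * y b].
Proof.
move=> M0; pose A : 'M[R]_#|T| := \matrix_(i, j) M (enum_val i) (enum_val j).
have [|r [r0 rx ry]] := @perron_row _ A; first by move=> i j; rewrite mxE.
have sumE (x : 'rV[R]_#|T|) b :
    \sum_c x 0 (enum_rank c) * M c b = (x *m A) 0 (enum_rank b).
  rewrite mxE (reindex (fun i : 'I_#|T| => enum_val i)) /=; last first.
    by apply: onW_bij; apply: enum_val_bij.
  by apply: eq_bigr => i _; rewrite mxE enum_valK enum_rankK.
exists r; split=> // [/rx [x [x0 [j xj] xA]]|t /ry [y [y0 yA]]].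
  exists (fun b => x 0 (enum_rank b)); split=> // [|b].
    by exists (enum_val j); rewrite enum_valK.
  by rewrite sumE xA mxE.
by exists (fun b => y 0 (enum_rank b)); split=> // b; rewrite sumE.
Qed.

End Perron.

(** * Growth orders n^d r^n *)

Section GrowthOrders.
Variable R : realType.
Implicit Types (r q s : R) (d : nat) (e u : nat -> R).

Definition rate r d (n : nat) : R := n%:R ^+ d * r ^+ n.

Definition theta e r d : Prop :=
  exists c C : R, [/\ 0 < c, 0 < C
    & exists N : nat, forall n : nat, (N <= n)%N ->
        c * rate r d n <= e n /\ e n <= C * rate r d n].

(** The lexicographic order on pairs, which for positive bases is asymptotic domination. *)
Definition rate_le r d r' d' : Prop := r < r' \/ r = r' /\ (d <= d')%N.

Lemma rate_ge0 r d n : 0 <= r -> 0 <= rate r d n.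
Proof. by move=> r0; rewrite mulr_ge0 ?exprn_ge0. Qed.

Lemma rate_gt0 r d n : 0 < r -> (0 < n)%N -> 0 < rate r d n.
Proof. by move=> r0 n0; rewrite mulr_gt0 ?exprn_gt0 ?ltr0n. Qed.

Lemma bernoulli r n : 0 <= r -> 1 + n%:R * r <= (1 + r) ^+ n.
Proof.
move=> r0; elim: n => [|n IH]; first by rewrite mul0r addr0 expr0.
rewrite exprS -natr1; apply: (@le_trans _ _ ((1 + r) * (1 + n%:R * r))).
  have : 0 <= n%:R * (r * r) by rewrite !mulr_ge0.
  by set k := n%:R; lra.
by rewrite ler_pM2l //; lra.
Qed.

(** Induction on [d]: a factor [n] is absorbed by passing to a base [s] halfway to [r], since
    [(r / s) ^+ n] grows at least linearly by [bernoulli]. *)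
Lemma rate_le_geometric q r d : 0 <= q -> q < r ->
  exists K, 0 < K /\ forall n, rate q d n <= K * r ^+ n.
Proof.
elim: d q r => [|d IH] q r q0 qr.
  exists 1; split=> // n; rewrite /rate expr0 !mul1r.
  by apply: lerXn2r; rewrite ?nnegrE //; lra.
have [K [K0 Kq]] := IH q ((q + r) / 2) q0 ltac:(lra).
pose s := (q + r) / 2; have s0 : 0 < s by rewrite /s; lra.
have rs : r = s * (1 + (r - s) / s) by field; rewrite gt_eqF.
pose k := (r - s) / s; have k0 : 0 < k by rewrite divr_gt0 // /s; lra.
exists (K / k); split=> [|n]; first by rewrite divr_gt0.
have -> : rate q d.+1 n = n%:R * rate q d n by rewrite /rate exprS mulrA.
apply: (@le_trans _ _ (n%:R * (K * s ^+ n))); first by rewrite ler_wpM2l ?Kq.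
have -> : r ^+ n = s ^+ n * (1 + k) ^+ n by rewrite -exprMn -rs.
have -> : K / k * (s ^+ n * (1 + k) ^+ n) = K * s ^+ n * ((1 + k) ^+ n / k) by ring.
rewrite mulrC; apply: ler_wpM2l; first by rewrite mulr_ge0 ?exprn_ge0 // ltW.
rewrite ler_pdivlMr //; apply: le_trans (bernoulli n (ltW k0)).
by rewrite lerDr.
Qed.

Lemma natr_gt_ev (K : R) : exists N : nat, forall n, (N <= n)%N -> K < n%:R.
Proof.
exists (Num.truncn K).+1 => n Nn.
by apply: lt_le_trans (truncnS_gt K) _; rewrite ler_nat.
Qed.

Lemma rate_little_o r d r' d' (K : R) :
  0 <= r -> 0 < r' -> 0 < K -> r < r' \/ r = r' /\ (d < d')%N ->
  exists N, forall n, (N <= n)%N -> K * rate r d n < rate r' d' n.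
Proof.
move=> r0 r'0 K0 [rr'|[-> dd']].
  (* Degree [d.+1] is bounded instead of [d], which leaves a spare factor [n] to beat every
     constant. *)
  have [K1 [K10 K1r]] := rate_le_geometric d.+1 r0 rr'.
  have [N NK] := natr_gt_ev (K * K1).
  exists N.+1 => n Nn; have n0 : 0 < n%:R :> R by rewrite ltr0n (leq_trans _ Nn).
  rewrite -(ltr_pM2l n0).
  have -> : n%:R * (K * rate r d n) = K * rate r d.+1 n by rewrite /rate exprS; ring.
  apply: (@le_lt_trans _ _ (K * (K1 * r' ^+ n))); first by rewrite ler_pM2l.
  rewrite mulrA; apply: (@lt_le_trans _ _ (n%:R * r' ^+ n)).
    by rewrite ltr_pM2r ?exprn_gt0 // NK // ltnW.
  rewrite ler_pM2l // /rate ler_peMl ?exprn_ge0 // ?(ltW r'0) //.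
  by rewrite exprn_ege1 // ler1n (leq_trans _ Nn).
have [N NK] := natr_gt_ev K.
exists N.+1 => n Nn; have n0 : 0 < n%:R :> R by rewrite ltr0n (leq_trans _ Nn).
rewrite /rate mulrA ltr_pM2r ?exprn_gt0 //.
apply: (@lt_le_trans _ _ (n%:R ^+ d.+1)).
  by rewrite exprS ltr_pM2r ?exprn_gt0 // NK // ltnW.
by rewrite ler_weXn2l // ler1n (leq_trans _ Nn).
Qed.

Lemma rate_leP r d r' d' : 0 <= r -> 0 < r' -> rate_le r d r' d' ->
  exists N, forall n, (N <= n)%N -> rate r d n <= rate r' d' n.
Proof.
move=> r0 r'0; case=> [rr'|[-> ]].
  have [|N HN] := @rate_little_o r d r' d' 1 r0 r'0 ltr01; first by left.
  by exists N => n /HN; rewrite mul1r => /ltW.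
rewrite leq_eqVlt => /orP[/eqP->|dd']; first by exists 0%N.
have [|N HN] := @rate_little_o r' d r' d' 1 (ltW r'0) r'0 ltr01; first by right.
by exists N => n /HN; rewrite mul1r => /ltW.
Qed.

Lemma rate_le_total r d r' d' : rate_le r d r' d' \/ rate_le r' d' r d.
Proof.
have [h|h|->] := ltgtP r r'; [by left; left|by right; left|].
by case/orP: (leq_total d d') => h; [left|right]; right.
Qed.

(** Were [(r, d)] strictly above [(r', d')], the lower bound for [e] would outgrow the upper bound
    for [K * u] by [rate_little_o]. *)
Lemma theta_le_rate e u r d r' d' (K : R) :
  0 < r -> 0 <= r' -> 0 < K ->
  (exists c, 0 < c /\ exists N, forall n, (N <= n)%N -> c * rate r d n <= e n) ->
  (exists C, 0 < C /\ exists N, forall n, (N <= n)%N -> u n <= C * rate r' d' n) ->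
  (exists N, forall n, (N <= n)%N -> e n <= K * u n) -> rate_le r d r' d'.
Proof.
move=> r0 r'0 K0 [c [c0 [N HN]]] [C [C0 [N' HN']]] [N2 HN2].
have : rate_le r d r' d' \/ (r' < r \/ r' = r /\ (d' < d)%N).
  have [h|h|->] := ltgtP r r'; [by left; left|by right; left|].
  by have [h|h] := leqP d d'; [left; right|right; right].
case=> // lt; exfalso.
have cK : 0 < K * C / c by rewrite !(mulr_gt0, invr_gt0).
have [M HM] := rate_little_o r'0 r0 cK lt.
pose n := maxn M (maxn N (maxn N' N2)).
have := HM n (leq_maxl _ _); apply/negP; rewrite -leNgt.
have -> : K * C / c * rate r' d' n = (K * (C * rate r' d' n)) / c by ring.
rewrite ler_pdivlMr // mulrC.
apply: le_trans (HN n _) _; first by rewrite /n !leq_max leqnn !orbT.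
apply: le_trans (HN2 n _) _; first by rewrite /n !leq_max leqnn !orbT.
by rewrite ler_pM2l //; apply: HN'; rewrite /n !leq_max leqnn !orbT.
Qed.

(** The eventually zero alternative accounts for letters erased by some power of the morphism. *)
Definition regular e : Prop :=
  (exists N : nat, forall n, (N <= n)%N -> e n = 0) \/
  exists r d, 1 <= r /\ theta e r d.

Lemma eq_regular e u : e =1 u -> regular e -> regular u.
Proof. by move=> /funext ->. Qed.

Lemma theta_add_le e u r d r' d' : 1 <= r -> 1 <= r' -> rate_le r d r' d' ->
  theta e r d -> theta u r' d' -> theta (fun n => e n + u n) r' d'.
Proof.
move=> r1 r'1 le [c [C [c0 C0 [N HN]]]] [c' [C' [c'0 C'0 [N' HN']]]].
have [||N2 HN2] := rate_leP _ _ le; [lra|lra|].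
exists c', (C + C'); split=> //; first by lra.
exists (maxn N (maxn N' N2)) => n; rewrite !geq_max => /and3P[h1 h2 h3].
have [a1 a2] := HN n h1; have [a3 a4] := HN' n h2; have a5 := HN2 n h3.
have b0 : 0 <= c * rate r d n by rewrite mulr_ge0 ?rate_ge0 //; lra.
split; first by lra.
rewrite mulrDl; apply: lerD => //; apply: le_trans a2 _.
by rewrite ler_pM2l.
Qed.

Lemma regular_add e u : regular e -> regular u -> regular (fun n => e n + u n).
Proof.
have ev0 e1 e2 : (exists N : nat, forall n, (N <= n)%N -> e1 n = 0) ->
    regular e2 -> regular (fun n => e1 n + e2 n).
  move=> [N HN] [[N' HN']|[r [d [r1 [c [C [c0 C0 [N' HN']]]]]]]].
    left; exists (maxn N N') => n; rewrite geq_max => /andP[h1 h2].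
    by rewrite HN // HN' // addr0.
  right; exists r, d; split=> //; exists c, C; split=> //.
  exists (maxn N N') => n; rewrite geq_max => /andP[h1 h2].
  by rewrite HN // add0r; apply: HN'.
move=> [e0|[r [d [r1 he]]]] hu; first exact: ev0.
case: hu => [u0|[r' [d' [r'1 hu]]]].
  apply: (@eq_regular (fun n => u n + e n)); first by move=> n; rewrite addrC.
  by apply: ev0 => //; right; exists r, d.
right; case: (rate_le_total r d r' d') => le.
  by exists r', d'; split=> //; apply: theta_add_le le he hu.
exists r, d; split=> //; rewrite (_ : (fun n => _) = (fun n => u n + e n)).
  exact: theta_add_le le hu he.
by apply: funext => n; rewrite addrC.
Qed.

Lemma regular_squeeze e u (c C : R) : 0 < c -> 0 < C ->
  (forall n, c * u n <= e n /\ e n <= C * u n) -> regular u -> regular e.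
Proof.
move=> c0 C0 eu [[N HN]|[r [d [r1 [k [K [k0 K0 [N HN]]]]]]]].
  left; exists N => n /HN u0; have [] := eu n; rewrite u0 !mulr0 => h1 h2.
  by apply/eqP; rewrite eq_le h1 h2.
right; exists r, d; split=> //; exists (c * k), (C * K).
split; [exact: mulr_gt0|exact: mulr_gt0|].
exists N => n /HN[h1 h2]; have [h3 h4] := eu n; rewrite -!mulrA; split.
  by apply: le_trans h3; rewrite ler_pM2l.
by apply: le_trans h4 _; rewrite ler_pM2l.
Qed.

Lemma regular_scale e (k : R) : 0 <= k -> regular e -> regular (fun n => k * e n).
Proof.
rewrite le_eqVlt => /orP[/eqP<- _|k0].
  by left; exists 0%N => n _; rewrite mul0r.
by apply: (regular_squeeze k0 k0).
Qed.

Lemma regular_sum (T : Type) (s : seq T) (P : pred T) (F : T -> nat -> R) :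
  (forall i, P i -> regular (F i)) -> regular (fun n => \sum_(i <- s | P i) F i n).
Proof.
move=> rF; elim: s => [|i s IH].
  by left; exists 0%N => n _; rewrite big_nil.
case Pi : (P i).
  apply: (@eq_regular (fun n => F i n + \sum_(j <- s | P j) F j n)).
    by move=> n; rewrite big_cons Pi.
  by apply: regular_add => //; apply: rF.
by apply: eq_regular IH => n; rewrite big_cons Pi.
Qed.

Lemma rateS_le r d n : 0 <= r -> (0 < n)%N -> rate r d n.+1 <= 2 ^+ d * r * rate r d n.
Proof.
move=> r0 n0; rewrite /rate exprS.
have -> : 2 ^+ d * r * (n%:R ^+ d * r ^+ n) = (2 ^+ d * n%:R ^+ d) * (r * r ^+ n).
  by ring.
rewrite ler_wpM2r ?mulr_ge0 ?exprn_ge0 // -exprMn.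
apply: lerXn2r; rewrite ?nnegrE ?mulr_ge0 //.
by rewrite -natrM ler_nat mul2n -addnn -addn1 leq_add2l.
Qed.

Lemma rateS_ge r d n : 0 <= r -> r * rate r d n <= rate r d n.+1.
Proof.
move=> r0; rewrite /rate exprS mulrCA ler_wpM2r ?mulr_ge0 ?exprn_ge0 //.
by apply: lerXn2r; rewrite ?nnegrE ?ler_nat.
Qed.

Lemma rate_leS r d n : 1 <= r -> rate r d n <= rate r d n.+1.
Proof.
move=> r1; have r0 : 0 <= r by lra.
rewrite /rate exprS; apply: ler_pM; rewrite ?exprn_ge0 //.
  by apply: lerXn2r; rewrite ?nnegrE ?ler_nat.
by rewrite ler_peMl ?exprn_ge0.
Qed.

Lemma regular_unshift e u : (forall n, u n.+1 = e n) -> regular e -> regular u.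
Proof.
move=> ue [[N HN]|[r [d [r1 [c [C [c0 C0 [N HN]]]]]]]].
  by left; exists N.+1 => -[|n] // Nn; rewrite ue HN.
have r0 : 0 < r by lra.
pose k := 2 ^+ d * r; have k0 : 0 < k by rewrite mulr_gt0 ?exprn_gt0.
right; exists r, d; split=> //; exists (c / k), C; split=> //; first exact: divr_gt0.
exists N.+2 => -[|n] // Nn; rewrite ue.
have [h1 h2] := HN n (ltnW Nn); split.
  apply: le_trans h1; rewrite -mulrA ler_pM2l // mulrC ler_pdivrMr // mulrC.
  by apply: rateS_le (ltW r0) _; apply: leq_ltn_trans (leq0n N) Nn.
by apply: le_trans h2 _; rewrite ler_pM2l // rate_leS.
Qed.

Lemma ge_rec_ratio (v : nat -> R) (w : nat -> R) (N : nat) :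
  (forall n, (N <= n)%N -> 0 < w n) ->
  (forall c, 0 < c -> exists2 c', 0 < c' <= c & forall n, (N <= n)%N ->
      c' * w n <= v n -> c' * w n.+1 <= v n.+1) ->
  0 < v N ->
  exists c, 0 < c /\ forall n, (N <= n)%N -> c * w n <= v n.
Proof.
move=> w0 step vN.
have [c' /andP[c'0 c'le] stepc] := step (v N / w N) (divr_gt0 vN (w0 N (leqnn N))).
exists c'; split=> // n; elim: n => [|n IH].
  rewrite leqn0 => /eqP N0; rewrite -N0.
  by apply: le_trans (ler_wpM2r _ c'le) _; rewrite ?divfK // ?gt_eqF ?ltW // w0.
rewrite leq_eqVlt => /orP[/eqP<-|]; last first.
  by rewrite ltnS => Nn; apply: stepc => //; apply: IH.
by apply: le_trans (ler_wpM2r _ c'le) _; rewrite ?divfK // ?gt_eqF ?ltW // w0.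
Qed.

Lemma le_rec_ratio (v : nat -> R) (w : nat -> R) (N : nat) :
  (forall n, (N <= n)%N -> 0 < w n) ->
  (forall C, 0 < C -> exists2 C', C <= C' & forall n, (N <= n)%N ->
      v n <= C' * w n -> v n.+1 <= C' * w n.+1) ->
  exists C, 0 < C /\ forall n, (N <= n)%N -> v n <= C * w n.
Proof.
move=> w0 step; have q0 : 0 < Num.max 1 (v N / w N) by rewrite lt_max ltr01.
have [C leC stepC] := step _ q0.
have base : v N <= C * w N.
  rewrite -ler_pdivrMr ?w0 //; apply: le_trans leC.
  by rewrite le_max lexx orbT.
exists C; split=> [|n]; first exact: lt_le_trans leC.
elim: n => [|n IH]; first by rewrite leqn0 => /eqP N0; rewrite -N0.
rewrite leq_eqVlt => /orP[/eqP<-//|]; rewrite ltnS => Nn.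
by apply: stepC => //; apply: IH.
Qed.

(* The particular solution dominates when the forcing term grows faster than
   [r ^+ n], and one power of [n] is gained at resonance. *)
Lemma regular_rec e u r : 1 <= r -> 0 < u 0%N -> (forall n, 0 <= e n) ->
  (forall n, u n.+1 = r * u n + e n) -> regular e -> regular u.
Proof.
move=> r1 u0 e0 uS reg; have r0 : 0 < r by lra.
have up n : 0 < u n.
  by elim: n => // n IH; rewrite uS ltr_wpDr // mulr_gt0.
have ulow n : u 0%N * r ^+ n <= u n.
  elim: n => [|n IH]; first by rewrite mulr1.
  rewrite uS exprS mulrCA; apply: ler_wpDr => //.
  by rewrite ler_pM2l.
right; case: reg => [[N HN]|[r' [d [r'1 [c [C [c0 C0 [N HN]]]]]]]].
  exists r, 0%N; split=> //; exists (u 0%N).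
  have w0 n : (N <= n)%N -> 0 < r ^+ n by move=> _; apply: exprn_gt0.
  have [|K [K0 HK]] := @le_rec_ratio u _ N w0.
    move=> K K0; exists K => // n Nn h; rewrite uS HN // addr0 exprS mulrCA.
    by rewrite ler_pM2l.
  exists K; split=> //; exists N => n Nn; rewrite /rate expr0 mul1r.
  by split; [exact: ulow|exact: HK].
have r'0 : 0 < r' by lra.
have [lt|lt|er] := ltgtP r' r.
- (* supersolution [u n + A q^n] with [r' < q < r] *)
  exists r, 0%N; split=> //; exists (u 0%N).
  pose q := (r' + r) / 2; have q0 : 0 < q by rewrite /q; lra.
  have [K [K0 HK]] := @rate_le_geometric r' q d (ltW r'0) ltac:(rewrite /q; lra).
  pose A := C * K / (r - q).
  have rq : 0 < r - q by rewrite /q; lra.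
  have A0 : 0 < A by rewrite divr_gt0 // mulr_gt0.
  have w0 n : (N <= n)%N -> 0 < r ^+ n by move=> _; apply: exprn_gt0.
  have Aq n : 0 <= A * q ^+ n by rewrite mulr_ge0 ?exprn_ge0 ?ltW.
  have [|L [L0 HL]] := @le_rec_ratio (fun n => u n + A * q ^+ n) _ N w0.
    move=> L L0; exists L => // n Nn h; rewrite uS.
    have [_ h2] := HN n Nn; have h3 : e n <= C * K * q ^+ n.
      by apply: le_trans h2 _; rewrite -mulrA ler_pM2l.
    have h4 : C * K * q ^+ n = A * (r - q) * q ^+ n by rewrite /A divfK // gt_eqF.
    have h5 : r * (u n + A * q ^+ n) <= r * (L * r ^+ n) by rewrite ler_pM2l.
    by rewrite !exprS; lra.
  exists L; split=> //; exists N => n Nn; rewrite /rate expr0 mul1r.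
  split; first exact: ulow.
  by apply: le_trans (HL n Nn); rewrite lerDl.
(* The forcing term wins. An upper constant survives a step as soon as [r * L' + C <= r' * L'],
   whence [C / (r' - r)]; the lower bound comes from the forcing term alone. *)
- exists r', d; split=> //.
  have w0 n : (N.+1 <= n)%N -> 0 < rate r' d n.
    by move=> Nn; rewrite rate_gt0 // (leq_trans _ Nn).
  have k0 : 0 < 2 ^+ d * r' by rewrite mulr_gt0 ?exprn_gt0.
  have [|L [L0 HL]] := @le_rec_ratio u _ N.+1 w0.
    move=> L L0; exists (Num.max L (C / (r' - r))); first by rewrite le_max lexx.
    set L' := Num.max _ _ => n Nn h; rewrite uS.
    have [_ h2] := HN n (ltnW Nn).
    have L'0 : 0 < L' by rewrite lt_max L0.
    have h3 : C <= L' * (r' - r).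
      by rewrite -ler_pdivrMr ?subr_gt0 // le_max lexx orbT.
    apply: (@le_trans _ _ (L' * (r' * rate r' d n))); last first.
      by rewrite ler_pM2l // rateS_ge // ltW.
    apply: (@le_trans _ _ (r * (L' * rate r' d n) + L' * (r' - r) * rate r' d n)).
      apply: lerD; first by rewrite ler_pM2l.
      by apply: le_trans h2 _; rewrite ler_wpM2r // rate_ge0 // ltW.
    by rewrite le_eqVlt; apply/orP; left; apply/eqP; ring.
  exists (c / (2 ^+ d * r')), L; split=> //; first exact: divr_gt0.
  exists N.+2 => -[|n] // Nn; split; last by apply: HL; apply: ltnW.
  have [h1 _] := HN n (ltnW Nn).
  rewrite uS; apply: ler_wpDl; first by rewrite mulr_ge0 // ltW.
  apply: le_trans h1; rewrite -mulrA ler_pM2l // mulrC ler_pdivrMr // mulrC.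
  by apply: rateS_le (ltW r'0) _; apply: leq_ltn_trans (leq0n N) Nn.
exists r, d.+1; split=> //; subst r'.
have w0 n : (N.+1 <= n)%N -> 0 < rate r d.+1 n.
  by move=> Nn; rewrite rate_gt0 // (leq_trans _ Nn).
(* [n^d <= (n+1)^(d+1) - n^(d+1) <= (d+1) 2^d n^d] *)
have dlow n : (n%:R : R) ^+ d.+1 + n%:R ^+ d <= n.+1%:R ^+ d.+1.
  rewrite !exprS -{2}[n%:R ^+ d]mul1r -mulrDl natr1 ler_pM2l ?ltr0n //.
  by apply: lerXn2r; rewrite ?nnegrE ?ler_nat.
have dup n : (0 < n)%N ->
    (n.+1%:R : R) ^+ d.+1 <= n%:R ^+ d.+1 + (2 ^+ d * d.+1%:R) * n%:R ^+ d.
  move=> n0; have le2 : (n.+1%:R : R) <= 2 * n%:R.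
    by rewrite -natrM ler_nat mul2n -addnn -addn1 leq_add2l.
  elim: (d) => [|k IH].
    by rewrite !expr1 !expr0 mul1r mulr1 natr1.
  rewrite exprS; apply: (le_trans (ler_wpM2l _ IH)) => //.
  have hA : k.+1%:R * (2 ^+ k * n%:R ^+ k * n.+1%:R)
         <= k.+1%:R * (2 ^+ k * n%:R ^+ k * (2 * n%:R)) :> R.
    by rewrite ler_wpM2l // ler_wpM2l // mulr_ge0 ?exprn_ge0.
  have hB : n%:R * (n%:R : R) ^+ k <= 2 * 2 ^+ k * (n%:R * n%:R ^+ k).
    by rewrite ler_peMl ?mulr_ge0 ?exprn_ge0 // -exprS exprn_ege1 // ler1n.
  move: hA hB; rewrite !exprS -[k.+2%:R]natr1 -[n.+1%:R]natr1.
  by set x := n%:R ^+ k; set z := 2 ^+ k; set m := n%:R; set K := k.+1%:R; lra.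
have [|//|l [l0 Hl]] := @ge_rec_ratio u _ N.+1 w0.
  (* By [dup], one step raises [l' * rate r d.+1] beyond the factor [r] by at most
     [l' * D * rate r d n]; the choice [l' <= c / D] lets the forcing term pay for it. *)
  move=> l l0; pose D : R := 2 ^+ d * d.+1%:R * r.
  have D0 : 0 < D by rewrite !mulr_gt0 ?exprn_gt0 ?ltr0n.
  exists (Num.min l (c / D)).
    by rewrite ge_min lexx lt_min l0 divr_gt0.
  set l' := Num.min _ _ => n Nn h.
  have l'0 : 0 < l' by rewrite lt_min l0 divr_gt0.
  have h1 : l' * D <= c by rewrite -ler_pdivlMr // ge_min lexx orbT.
  have [h2 _] := HN n (ltnW Nn).
  rewrite uS; apply: (@le_trans _ _ (r * (l' * rate r d.+1 n) + l' * D * rate r d n)).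
    rewrite {1}/rate [r ^+ n.+1]exprS.
    apply: (@le_trans _ _
      (l' * ((n%:R ^+ d.+1 + 2 ^+ d * d.+1%:R * n%:R ^+ d) * (r * r ^+ n)))).
      rewrite ler_pM2l // ler_pM2r ?mulr_gt0 ?exprn_gt0 // dup //.
      exact: leq_trans Nn.
    by rewrite le_eqVlt; apply/orP; left; apply/eqP; rewrite /rate /D; ring.
  apply: lerD; first by rewrite ler_pM2l.
  by apply: le_trans h2; rewrite ler_wpM2r // rate_ge0 // ltW.
have [|L [L0 HL]] := @le_rec_ratio u _ N.+1 w0.
  move=> L L0; exists (Num.max L C); first by rewrite le_max lexx.
  set L' := Num.max _ _ => n Nn h.
  have L'0 : 0 < L' by rewrite lt_max L0.
  have h1 : C <= L' * r.
    by apply: (@le_trans _ _ L'); [rewrite le_max lexx orbT|rewrite ler_peMr // ltW].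
  have [_ h2] := HN n (ltnW Nn).
  rewrite uS; apply: (@le_trans _ _ (r * (L' * rate r d.+1 n) + L' * r * rate r d n)).
    apply: lerD; first by rewrite ler_pM2l.
    by apply: le_trans h2 _; rewrite ler_wpM2r // rate_ge0 // ltW.
  apply: (@le_trans _ _ (L' * ((n%:R ^+ d.+1 + n%:R ^+ d) * (r * r ^+ n)))).
    by rewrite le_eqVlt; apply/orP; left; apply/eqP; rewrite /rate; ring.
  rewrite ler_pM2l // {1}/rate [r ^+ n.+1]exprS ler_pM2r ?mulr_gt0 ?exprn_gt0 //.
by exists l, L; split=> //; exists N.+1 => n Nn; split; [exact: Hl|exact: HL].
Qed.

End GrowthOrders.

(** * Lengths of iterated morphisms *)

Section Iteration.
Variables (B : Type) (f : B -> seq B).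

Lemma iter_mext n (w : seq B) : iter n (mext f) w = mext (mpow f n) w.
Proof.
elim: w => [|b w IH]; first by elim: n => //= n ->.
rewrite -cat1s mext_cat -IH /mext /= cats0 /mpow -/(mext f).
by elim: n {IH} => //= n ->; rewrite mext_cat.
Qed.

Lemma mpowD m n b : mpow f (m + n) b = mext (mpow f m) (mpow f n b).
Proof. by rewrite /mpow iterD iter_mext. Qed.

Lemma mpow1 b : mpow f 1 b = f b.
Proof. by rewrite /mpow /= /mext /= cats0. Qed.

Lemma mpowS m b : mpow f m.+1 b = mext (mpow f m) (f b).
Proof. by rewrite -addn1 mpowD mpow1. Qed.

Lemma mpowSr m b : mpow f m.+1 b = mext f (mpow f m b).
Proof. by []. Qed.

End Iteration.

Lemma mpowM (B : Type) (f : B -> seq B) m n b : mpow (mpow f m) n b = mpow f (m * n) b.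
Proof.
elim: n b => [|n IH] b; first by rewrite muln0.
by rewrite mpowS mulnSr mpowD /mext; congr flatten; apply: eq_map => c; apply: IH.
Qed.

Lemma mem_mext (A B : eqType) (f : B -> seq A) w c :
  reflect (exists2 b, b \in w & c \in f b) (c \in mext f w).
Proof.
apply: (iffP flattenP) => [[s /mapP[b bw ->]]|[b bw cb]]; first by exists b.
by exists (f b) => //; apply: map_f.
Qed.

Lemma big_mext (R : nmodType) (A B : Type) (f : B -> seq A) (x : A -> R) w :
  \sum_(c <- mext f w) x c = \sum_(b <- w) \sum_(c <- f b) x c.
Proof. by rewrite big_flatten big_map. Qed.

Lemma sum_count (R : pzSemiRingType) (B : finType) (x : B -> R) (w : seq B) :
  \sum_(c <- w) x c = \sum_c x c * (count_mem c w)%:R.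
Proof.
elim: w => [|b w IH].
  by rewrite big_nil big1 // => c _; rewrite mulr0.
rewrite big_cons IH.
rewrite [RHS](eq_bigr (fun c => x c * (b == c)%:R + x c * (count_mem c w)%:R)).
  rewrite big_split /=; congr (_ + _).
  rewrite (bigD1 b) //= eqxx mulr1 big1 ?addr0 // => c.
  by rewrite eq_sym => /negPf->; rewrite mulr0.
by move=> c _; rewrite /= natrD mulrDr.
Qed.

Section LetterGrowth.
Variables (R : realType) (B : finType) (f : B -> seq B).

Definition eigenfunctional (z : R) (x : B -> R) : Prop :=
  forall b, \sum_(c <- f b) x c = z * x b.

Local Notation len n b := ((size (mpow f n b))%:R : R).

Lemma lenE n b : len n b = \sum_(c <- mpow f n b) 1.
Proof. by rewrite big_const_seq count_predT iter_addr_0. Qed.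

Lemma lenS n b : len n.+1 b = \sum_(c <- f b) len n c.
Proof. by rewrite lenE mpowS big_mext; apply: eq_bigr => c _; rewrite lenE. Qed.

Lemma len_mem n k b c : c \in mpow f k b -> len n c <= len (n + k) b.
Proof.
move=> cb; rewrite lenE (lenE _ b) mpowD big_mext.
by rewrite [leRHS](big_rem c) //= lerDl sumr_ge0 // => i _; rewrite sumr_ge0.
Qed.

Lemma len_step : exists K : R, 0 < K /\ forall n b, len n.+1 b <= K * len n b.
Proof.
pose K : R := 1 + \sum_b (size (f b))%:R.
have K0 : 0 < K by rewrite ltr_pwDl // sumr_ge0.
exists K; split=> // n; elim: n => [|n IH] b.
  rewrite mulr1 mpow1 /K (bigD1 b) //= addrCA lerDl addr_ge0 //.
  by rewrite sumr_ge0.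
rewrite lenS [in leRHS]lenS mulr_sumr; exact: ler_sum.
Qed.

(** One more iteration multiplies lengths by at most [K], so the shift by [k] in [len_mem] costs
    only the factor [K ^+ k]. *)
Lemma len_comparable k b c : c \in mpow f k b ->
  exists K : R, 0 < K /\ forall n, len n c <= K * len n b.
Proof.
move=> cb; have [K [K0 HK]] := len_step.
exists (K ^+ k); split=> [|n]; first exact: exprn_gt0.
apply: le_trans (len_mem n cb) _.
elim: k {cb} => [|k IH]; first by rewrite addn0 mul1r.
rewrite addnS exprS -mulrA; apply: le_trans (HK _ _) _.
by rewrite ler_pM2l.
Qed.

Lemma connect_mpow b c : connect (fun b c => c \in f b) b c ->
  exists k, c \in mpow f k b.
Proof.
case/connectP => p; elim: p b => [|d p IH] b /=.
  by move=> _ ->; exists 0%N; rewrite mem_seq1.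
case/andP => db pth lst; have [k ck] := IH d pth lst.
by exists k.+1; rewrite mpowS; apply/mem_mext; exists d.
Qed.

Lemma connect_last (e : rel B) b c : connect e b c -> b != c ->
  exists2 d, connect e b d & e d c.
Proof.
case/connectP => p; case/lastP: p => [_ ->|p d]; first by rewrite eqxx.
rewrite rcons_path last_rcons => /andP[pth ed] -> _.
by exists (last b p) => //; apply/connectP; exists p.
Qed.

(* By induction on the number of letters accessible from [b].  On the strongly
   connected class C of [b], a right Perron vector u turns the lengths into the
   scalar recurrence s(n+1) = r s(n) + e(n), where s = sum_C u_c len_c and e
   only involves letters outside C; within C all lengths are comparable. *)
Lemma len_regular b : regular (fun n => len n b).
Proof.
pose e := fun b c => c \in f b.
have [m] := ubnP #|connect e b|; elim: m b => // m IH b lt_m.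
pose C c := connect e b c && connect e c b.
have regU c : connect e b c -> ~~ C c -> regular (fun n => len n c).
  rewrite /C => bc; rewrite bc /= => ncb; apply: IH; rewrite -ltnS.
  apply: leq_trans lt_m; rewrite ltnS; apply: proper_card.
  apply/properP; split.
    by apply/fintype.subsetP => d; apply: connect_trans.
  by exists b => //; apply: connect0.
(* When no letter of [f b] lies in the class of [b], the lengths of [b] are a shifted sum of
   sequences covered by the induction. *)
have [noC|] := boolP (all (fun c => ~~ C c) (f b)).
  apply: (@regular_unshift _ (fun n => \sum_(c <- f b) len n c)).
    by move=> n; rewrite lenS.
  apply: (@eq_regular _ (fun n => \sum_(c <- f b | c \in f b) len n c)).
    by move=> n; rewrite -big_seq.
  apply: regular_sum => c cb; apply: regU; first exact: connect1.
  exact: (allP noC).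
case/allPn => c0 c0b; rewrite negbK => /andP[_ c0C].
have Cb : C b by rewrite /C !connect0.
have predC c : C c -> exists2 j, C j & c \in f j.
  case/andP => bc cb; have [->{c bc cb}|nbc] := eqVneq c b.
    have [E|nc] := eqVneq c0 b; first by exists b; rewrite // -{1}E.
    have [j c0j jb] := connect_last c0C nc.
    exists j => //; rewrite /C (connect1 jb) andbT.
    by apply: connect_trans c0j; apply: connect1.
  rewrite eq_sym in nbc; have [j bj jc] := connect_last bc nbc.
  by exists j; rewrite // /C bj; apply: connect_trans cb; apply: connect1.
pose M j c : R := if C j && C c then (count_mem c (f j))%:R else 0.
have M0 j c : 0 <= M j c by rewrite /M; case: ifP.
have M1 j c : C j -> C c -> c \in f j -> 1 <= M j c.
  by move=> Cj Cc cj; rewrite /M Cj Cc ler1n -has_count has_pred1.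
have [r [r0 xr yr]] := perron_fun M0.
(* Every letter of the class has a predecessor in it, so a supersolution [y] for [t], taken at its
   minimum [c] over [C], gives [y c <= t * y c], impossible for [t < 1]. *)
have r1 : 1 <= r.
  rewrite leNgt; apply/negP => rlt.
  have [|y [y0 yM]] := yr ((r + 1) / 2); first by lra.
  have [c Cc ymin] := @Order.TotalTheory.arg_minP _ _ _ b C y Cb.
  have [j Cj cj] := predC c Cc.
  have : y j <= \sum_j y j * M j c.
    rewrite (bigD1 j) //= ler_wpDr ?sumr_ge0 // => [i _|].
      by rewrite mulr_ge0 // ltW.
    by rewrite ler_peMr ?M1 // ltW.
  by have := ymin j Cj; have := yM c; have := y0 c; set Y := \sum_j _; nra.
have rpos : 0 < r by lra.
have [x [x0 [c1 xc1] xM]] := xr rpos.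
have Cx c : 0 < x c -> C c.
  move=> xc; apply/negPn/negP => nC.
  have := xM c; rewrite big1 => [/esym/eqP|j _]; last first.
    by rewrite /M (negPf nC) andbF mulr0.
  by rewrite mulf_eq0 !gt_eqF.
(* Positivity of [x] spreads along edges inside the class, because [r * x k] dominates [x j] when
   [k] occurs in [f j]; strong connectedness then gives [xC]. *)
have xpath p j : 0 < x j -> path e j p -> C (last j p) -> 0 < x (last j p).
  elim: p j => [|k p IHp] j //= xj /andP[jk kp] Cl; apply: IHp => //.
  have Ck : C k.
    have /andP[bj _] := Cx j xj; have /andP[_ lb] := Cl.
    apply/andP; split; first by apply: connect_trans bj _; apply: connect1.
    by apply: connect_trans lb; apply/connectP; exists p.
  rewrite -(pmulr_rgt0 _ rpos) -xM (bigD1 j) //=.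
  apply: ltr_pwDl; last by apply: sumr_ge0 => i _; rewrite mulr_ge0.
  by rewrite mulr_gt0 //; apply: lt_le_trans (M1 _ _ (Cx j xj) Ck jk).
have xC c : C c -> 0 < x c.
  move=> Cc; have /andP[_ c1b] := Cx _ xc1; have /andP[bc _] := Cc.
  have /connectP[p pth lst] : connect e c1 c by apply: connect_trans bc.
  by rewrite lst; apply: xpath; rewrite // -lst.
pose s n := \sum_(j | C j) x j * len n j.
pose w c := \sum_(j | C j) x j * (count_mem c (f j))%:R.
have sS n : s n.+1 = r * s n + \sum_(c | ~~ C c) w c * len n c.
  transitivity (\sum_c w c * len n c).
    under [RHS]eq_bigr do rewrite mulr_suml.
    rewrite exchange_big; apply: eq_bigr => j _ /=.
    rewrite lenS sum_count mulr_sumr; apply: eq_bigr => c _.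
    by rewrite mulrA mulrAC.
  rewrite (bigID C) /=; congr (_ + _).
  rewrite mulr_sumr; apply: eq_bigr => c Cc; rewrite mulrA -xM; congr (_ * _).
  rewrite [RHS](bigID C) /= [X in _ = _ + X]big1 => [|j /negPf nC].
    by rewrite addr0; apply: eq_bigr => j Cj; rewrite /M Cj Cc.
  by rewrite /M nC mulr0.
have w0 c : 0 <= w c by apply: sumr_ge0 => j _; rewrite mulr_ge0.
have regs : regular s.
  apply: regular_rec r1 _ _ sS _.
  - rewrite /s (bigD1 b) //= ltr_pwDl ?mulr1 ?xC // sumr_ge0 // => j _.
    by rewrite mulr_ge0.
  - by move=> n; apply: sumr_ge0 => c _; rewrite mulr_ge0.
  apply: regular_sum => c nC; have [bc|nbc] := boolP (connect e b c).
    by apply: regular_scale => //; apply: regU.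
  rewrite (_ : w c = 0); first by left; exists 0%N => n _; rewrite mul0r.
  apply: big1 => j /andP[bj _]; rewrite (count_memPn _) ?mulr0 //.
  by apply: contra nbc => cj; apply: connect_trans bj _; apply: connect1.
(* Comparability inside the class places [s n] between [x b] and [S] times the length at [b]. *)
have /boolp.choice[K HK] : forall j, exists k : R,
    C j -> 0 < k /\ forall n, len n j <= k * len n b.
  move=> j; have [Cj|_] := boolP (C j); last by exists 0.
  have /andP[bj _] := Cj; have [k /len_comparable[L HL]] := connect_mpow bj.
  by exists L.
pose S := \sum_(j | C j) x j * K j.
have S0 : 0 < S.
  rewrite /S (bigD1 b) //= ltr_pwDl //; last first.
    by apply: sumr_ge0 => j /andP[/HK[/ltW Kj _] _]; rewrite mulr_ge0.
  by rewrite mulr_gt0 ?xC //; have [] := HK b Cb.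
have iS0 : 0 < S^-1 by rewrite invr_gt0.
have ix0 : 0 < (x b)^-1 by rewrite invr_gt0 xC.
apply: regular_squeeze iS0 ix0 _ regs => n; split.
  rewrite mulrC ler_pdivrMr // /S mulrC mulr_suml; apply: ler_sum => j Cj.
  by rewrite -mulrA ler_wpM2l //; have [_] := HK j Cj.
rewrite mulrC ler_pdivlMr ?xC // mulrC /s (bigD1 b) //= lerDl.
by apply: sumr_ge0 => j _; rewrite mulr_ge0.
Qed.

Lemma super_eigenfunctional_mpow (y : B -> R) t n b : 0 <= t ->
  (forall b, \sum_(c <- f b) y c <= t * y b) ->
  \sum_(c <- mpow f n b) y c <= t ^+ n * y b.
Proof.
move=> t0 yt; elim: n => [|n IH]; first by rewrite big_seq1 mul1r.
rewrite mpowSr big_mext; apply: (@le_trans _ _ (\sum_(c <- mpow f n b) t * y c)).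
  exact: ler_sum.
by rewrite -mulr_sumr exprS -mulrA ler_wpM2l.
Qed.

Lemma eigenfunctional_mpow (x : B -> R) z n b : eigenfunctional z x ->
  \sum_(c <- mpow f n b) x c = z ^+ n * x b.
Proof.
move=> xz; elim: n => [|n IH]; first by rewrite big_seq1 mul1r.
by rewrite mpowSr big_mext (eq_bigr _ (fun c _ => xz c)) -mulr_sumr IH exprS mulrA.
Qed.

Lemma sum_le_len (y : B -> R) : exists K : R, 0 < K /\
  forall w : seq B, `|\sum_(c <- w) y c| <= K * (size w)%:R.
Proof.
pose K : R := 1 + \sum_b `|y b|.
have yK c : `|y c| <= K by rewrite /K (bigD1 c) //= addrCA lerDl addr_ge0 ?sumr_ge0.
exists K; split=> [|w]; first by rewrite ltr_pwDl ?sumr_ge0.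
apply: le_trans (ler_norm_sum _ _ _) _.
apply: (@le_trans _ _ (\sum_(c <- w) K)); first exact: ler_sum.
by rewrite big_const_seq count_predT iter_addr_0 mulr_natr.
Qed.

Lemma len_le_sum (y : B -> R) : (forall b, 0 < y b) -> exists K : R, 0 < K /\
  forall w : seq B, (size w)%:R <= K * \sum_(c <- w) y c.
Proof.
move=> y0; pose K : R := 1 + \sum_b (y b)^-1.
have iy b : 0 <= (y b)^-1 by rewrite invr_ge0 ltW.
have yK c : 1 <= K * y c.
  rewrite -ler_pdivrMr // div1r /K (bigD1 c) //= addrCA lerDl.
  by rewrite addr_ge0 ?sumr_ge0.
exists K; split=> [|w]; first by rewrite ltr_pwDl ?sumr_ge0.
rewrite mulr_sumr; elim: w => [|c w IH]; first by rewrite big_nil.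
by rewrite big_cons /= -nat1r; apply: lerD.
Qed.

Section Rate.
Variables (a : B) (mu : R) (d : nat).
Hypotheses (mu1 : 1 <= mu) (acc : forall b, exists k, b \in mpow f k a).
Hypothesis (grow : theta (fun n => len n a) mu d).

(** [z ^+ n * |x b|] is at most a constant times |f^n(b)|, hence times |f^n(a)| by accessibility.
    The identity is asked along the iterates of [b] only, so that eigenfunctionals of a sub-alphabet
    qualify. *)
Lemma eigenvalue_le_rate z x b :
  0 <= z -> (forall n, \sum_(c <- mpow f n b) x c = z ^+ n * x b) ->
  x b != 0 -> z <= mu.
Proof.
rewrite le_eqVlt => /orP[/eqP<- _ _|z0 xz xb]; first exact: le_trans mu1.
have [k /len_comparable[L [L0 HL]]] := acc b.
have [K [K0 HK]] := sum_le_len x.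
have [c [C [c0 C0 [N HN]]]] := grow.
have KL : 0 < K * L by rewrite mulr_gt0.
suff [|[-> _]] : rate_le z 0 mu d by [move/ltW|].
apply: (@theta_le_rate _ (fun n => z ^+ n * `|x b|) (fun n => len n a) _ _ _ _ _ z0 _ KL).
- exact: le_trans mu1.
- exists `|x b|; split; first by rewrite normr_gt0.
  by exists 0%N => n _; rewrite /rate expr0 mul1r mulrC.
- by exists C; split=> //; exists N => n /HN[].
exists 0%N => n _; rewrite -mulrA; apply: (@le_trans _ _ (K * len n b)).
  rewrite -[X in X * _ <= _]gtr0_norm ?exprn_gt0 // -normrM.
  by rewrite -xz.
by rewrite ler_pM2l.
Qed.

(** The Perron value [r] equals [mu]: if [r < mu], a positive supersolution for the midpoint [t]
    bounds lengths by a multiple of [t ^+ n], below their order, while [r <= mu] is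
    [eigenvalue_le_rate]. *)
Lemma rate_eigenfunctional :
  exists x, [/\ forall b, 0 <= x b, exists b, 0 < x b & eigenfunctional mu x].
Proof.
have M0 (c b : B) : (0 : R) <= (count_mem c (f b))%:R by [].
have [r [r0 xr yr]] := perron_fun M0.
have ler : mu <= r.
  rewrite leNgt; apply/negP => rlt; pose t := (r + mu) / 2.
  have [|y [y0 yM]] := yr t; first by rewrite /t; lra.
  have yt b : \sum_(c <- f b) y c <= t * y b by rewrite sum_count.
  have t0 : 0 < t by have := mu1; rewrite /t; lra.
  have [K [K0 HK]] := len_le_sum y0.
  have [c [C [c0 C0 [N HN]]]] := grow.
  have : rate_le mu d t 0.
    apply: (@theta_le_rate _ (fun n => len n a)
      (fun n => \sum_(c <- mpow f n a) y c) _ _ _ _ _ _ (ltW t0) K0).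
    - exact: lt_le_trans mu1.
    - by exists c; split=> //; exists N => n /HN[].
    - exists (y a); split=> //; exists 0%N => n _; rewrite /rate expr0 mul1r mulrC.
      by apply: super_eigenfunctional_mpow => //; apply: ltW.
    by exists 0%N.
  by case=> [|[+ _]]; rewrite /t; lra.
have rpos : 0 < r by have := mu1; lra.
have [x [x0 [b xb] xM]] := xr rpos.
have xz : eigenfunctional r x by move=> c; rewrite sum_count.
exists x; split=> //; first by exists b.
suff <- : r = mu by [].
apply/eqP; rewrite eq_le ler andbT.
apply: (eigenvalue_le_rate (ltW rpos) _ (lt0r_neq0 xb)) => n.
exact: eigenfunctional_mpow.
Qed.

End Rate.

End LetterGrowth.

Lemma sum_count_enum (R : pzSemiRingType) (B : finType) (x : B -> R) (w : seq B) :
  \sum_(c <- w) x c =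
  \sum_(i < #|B|) x (enum_val i) * (count_mem (enum_val i) w)%:R.
Proof.
rewrite sum_count (reindex (fun i : 'I_#|B| => enum_val i)) //=.
by apply: onW_bij; apply: enum_val_bij.
Qed.

(** * Real eigenvalues and real eigenfunctionals *)

Section RealSpectrum.
Variables (R : realType) (B : finType) (f : B -> seq B).

(** The matrix and [z] being real, the real and imaginary parts of a complex eigenvector are
    eigenfunctionals, and one of them is nonzero. *)
Lemma SpecP (z : R) :
  z%:C \in Spec R f <->
  exists x : B -> R, (exists b, x b != 0) /\ eigenfunctional f z x.
Proof.
rewrite inE; split=> [/eigenvalueP[v vM v0]|[x [[b xb] xz]]]; last first.
  apply/eigenvalueP; exists (\row_i (x (enum_val i))%:C).
    apply/rowP => j; rewrite !mxE -rmorphM -(xz (enum_val j)) [in RHS]sum_count_enum.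
    rewrite rmorph_sum; apply: eq_bigr => i _; rewrite !mxE rmorphM /=.
    by rewrite rmorph_nat.
  apply/eqP => /rowP/(_ (enum_rank b)); rewrite !mxE enum_rankK => /eqP.
  by rewrite fmorph_eq0 (negPf xb).
have part (g : R[i] -> R) : {morph g : u w / u + w} ->
    (forall k u, g (k%:C * u) = k * g u) ->
    eigenfunctional f z (fun b => g (v 0 (enum_rank b))).
  move=> gD gz b; have g0 : g 0 = 0 by have := gz 0 0; rewrite mulr0 mul0r.
  have gM u (k : nat) : g (u * k%:R) = g u * k%:R.
    by rewrite mulrC [g u * _]mulrC -gz rmorph_nat.
  rewrite -gz; move/rowP/(_ (enum_rank b)): vM; rewrite [RHS]mxE => <-.
  rewrite mxE (big_morph g gD g0) [in LHS]sum_count_enum.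
  apply: eq_bigr => i _; rewrite !mxE enum_rankK enum_valK.
  by rewrite gM.
have [j vj] : exists j, v 0 j != 0.
  apply/existsP; apply: contraNT v0; rewrite negb_exists => /forallP v0.
  by apply/eqP/rowP => j; rewrite mxE; apply/eqP; rewrite -[_ == _]negbK.
have [re0|re0] := eqVneq (complex.Re (v 0 j)) 0.
  exists (fun b => complex.Im (v 0 (enum_rank b))); split; last first.
    by apply: part => [[u1 u2] [w1 w2]|k [u1 u2]] //=; rewrite mul0r addr0.
  exists (enum_val j); rewrite enum_valK; apply: contraNneq vj => im0.
  by apply/eqP; apply/eqP; rewrite eq_complex re0 im0 !eqxx.
exists (fun b => complex.Re (v 0 (enum_rank b))); split; last first.
  by apply: part => [[u1 u2] [w1 w2]|k [u1 u2]] //=; rewrite mul0r subr0.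
by exists (enum_val j); rewrite enum_valK.
Qed.

End RealSpectrum.

(** * Supports of the iterates *)

Section Supports.

Lemma mem_mpow_trans (B : eqType) (f : B -> seq B) m n b c d :
  d \in mpow f m b -> c \in mpow f n d -> c \in mpow f (n + m) b.
Proof. by move=> db cd; rewrite mpowD; apply/mem_mext; exists d. Qed.

Lemma mulmx_gt0P n (P Q : 'M[nat]_n) i j :
  reflect (exists2 k, (0 < P i k)%N & (0 < Q k j)%N) (0 < (P *m Q) i j)%N.
Proof.
have -> : (P *m Q) i j = (\sum_k (P i k * Q k j)%N)%N by rewrite mxE.
apply: (iffP idP) => [|[k Pk Qk]].
  rewrite lt0n sum_nat_eq0 negb_forall => /existsP[k].
  by rewrite -lt0n muln_gt0 => /andP[]; exists k.
by rewrite (bigD1 k) //= addn_gt0 muln_gt0 Pk Qk.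
Qed.

(** Positive entries of powers are walks, and [iota] carries walks of [P] to walks of [Q]. It serves
    both for diagonal blocks and for renumbering by a permutation. *)
Lemma expmx_gt0_sub m n (P : 'M[nat]_m) (Q : 'M[nat]_n) (iota : 'I_m -> 'I_n) :
  (forall i j, P i j = Q (iota i) (iota j)) ->
  forall k i j, (0 < (P ^+ k) i j)%N -> (0 < (Q ^+ k) (iota i) (iota j))%N.
Proof.
move=> PQ; elim=> [|k IH] i j.
  rewrite !expr0 !mxE; case: eqP => // -> _; by rewrite eqxx.
rewrite !exprS => /mulmx_gt0P[l Pl Pk]; apply/mulmx_gt0P.
by exists (iota l); [rewrite -PQ|apply: IH].
Qed.

(** Every row of [P] has a positive entry because [P ^+ k] is positive, so positivity persists when
    the exponent grows. *)
Lemma primitive_mx_diag n (P : 'M[nat]_n) : primitive_mx P ->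
  exists k, forall m, (k <= m)%N -> forall i j, (0 < (P ^+ m) i j)%N.
Proof.
move=> [k [k0 Pk]]; exists k => m /subnKC <-; elim: (m - k)%N => [|l IH] i j.
  by rewrite addn0; apply: Pk.
have : (0 < (P ^+ k) i j)%N by apply: Pk.
rewrite -(prednK k0) exprS => /mulmx_gt0P[c Pc _].
by rewrite addnS exprS; apply/mulmx_gt0P; exists c; rewrite ?prednK.
Qed.

(** The level records the position of the diagonal block. A primitive block has positive diagonal
    entries in all large powers; an index with a zero block is alone on its level. *)
Lemma block_levels n (N : 'M[nat]_n) : primitive_block_triangular N ->
  exists lev : 'I_n -> nat,
    (forall i j, (0 < N i j)%N -> (lev i <= lev j)%N) /\
    forall i, (exists k, forall m, (k <= m)%N -> (0 < (N ^+ m) i i)%N) \/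
      N i i = 0%N /\ forall j, lev j = lev i -> j = i.
Proof.
move=> [k [q [E /= [q0 tri prim]]]].
set N' := castmx (E, E) N in tri prim.
have NE i j : N i j = N' (cast_ord E i) (cast_ord E j).
  by rewrite castmxE !cast_ordK.
pose l i : nat := tagnat.sig1 (cast_ord E i).
have lev i j : (0 < N i j)%N ->
    submxblock N' (tagnat.sig1 (cast_ord E i)) (tagnat.sig1 (cast_ord E j)) != 0.
  apply: contraTneq => /matrixP/(_ (tagnat.sig2 _) (tagnat.sig2 _)).
  by rewrite !mxE !tagnat.sig2K -NE => ->.
have diag i : (exists k, forall m, (k <= m)%N -> (0 < (N ^+ m) i i)%N) \/
    N i i = 0%N /\ forall j, l j = l i -> j = i.
  pose i' := cast_ord E i; case: (prim (tagnat.sig1 i')) => [|[q1 B0]].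
    case/primitive_mx_diag => m Pm; left; exists m => m' le_m.
    have := @expmx_gt0_sub _ _ (submxblock N' (tagnat.sig1 i') (tagnat.sig1 i')) N
      (fun u => cast_ord (esym E) (tagnat.Rank (tagnat.sig1 i') u)) _ m' _ _
      (Pm m' le_m (tagnat.sig2 i') (tagnat.sig2 i')).
    rewrite tagnat.sig2K /i' cast_ordK; apply.
    by move=> u v; rewrite mxE NE !cast_ordKV.
  right; split.
    apply/eqP; rewrite -leqn0 leqNgt; apply/negP => /lev.
    by rewrite -/i' B0 eqxx.
  move=> j lji; apply: (@cast_ord_inj _ _ E); rewrite -/i'.
  have /val_inj sji : val (tagnat.sig1 (cast_ord E j)) = val (tagnat.sig1 i') by [].
  rewrite -[LHS]tagnat.sigK -[RHS]tagnat.sigK; congr tagnat.rank.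
  rewrite !tagnat.sigE12; move: (tagnat.sig2 _) (tagnat.sig2 _); rewrite sji.
  move=> u v; congr Tagged; apply: val_inj => /=.
  have := ltn_ord u; have := ltn_ord v.
  move: (nat_of_ord u) (nat_of_ord v) => {}u {}v.
  by rewrite q1 !ltnS !leqn0 => /eqP-> /eqP->.
case: tri => tri.
  exists l; split=> // i j /lev; apply: contraNleq => ltji; apply/eqP.
  exact: tri.
(* In the lower triangular case the blocks are numbered backwards, so that levels are monotone in
   the same direction. *)
exists (fun i => k - l i)%N; split=> [i j /lev nz|i].
  apply: leq_sub2l; move: nz; apply: contraNleq => ltij; apply/eqP; exact: tri.
case: (diag i) => [|[Ni li]]; [by left|right; split=> // j eqk; apply: li].
have : (l j < k)%N /\ (l i < k)%N by split; apply: ltn_ord.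
by case=> lj lii; rewrite -(subKn (ltnW lj)) eqk subKn // ltnW.
Qed.

Variable (B : finType).
Implicit Types (f : B -> seq B) (b c d : B).

Lemma incidence_expr f n i j :
  (incidence f ^+ n) i j = count_mem (enum_val i) (mpow f n (enum_val j)).
Proof.
elim: n i j => [|n IH] i j.
  rewrite expr0 mxE /= addn0 (inj_eq enum_val_inj) eq_sym.
  by case: eqP.
rewrite exprS mxE mpowSr count_flatten sumnE !big_map.
have cE (x : B -> nat) w : (\sum_(c <- w) x c =
    \sum_(k < #|B|) x (enum_val k) * count_mem (enum_val k) w)%N.
  transitivity (\sum_(c <- w) x c)%R => //.
  rewrite sum_count_enum; apply: eq_bigr => k _.
  by rewrite natn.
by rewrite cE; apply: eq_bigr => k _; rewrite IH mxE.
Qed.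

Lemma letter_levels f (s : 'S_(#|B|)) :
  primitive_block_triangular (perm_mx s^-1 *m incidence f *m perm_mx s) ->
  exists lev : B -> nat,
    (forall b c, c \in f b -> (lev c <= lev b)%N) /\
    forall b, (exists k, forall m, (k <= m)%N -> b \in mpow f m b) \/
      b \notin f b /\ forall c, lev c = lev b -> c = b.
Proof.
set M := _ *m _; have ME i j : M i j = incidence f (s^-1%g i) (s^-1%g j).
  by rewrite /M -row_permE -[X in perm_mx X](invgK s) -col_permE !mxE.
have cM i j : (0 < M i j)%N = (enum_val (s^-1%g i) \in f (enum_val (s^-1%g j))).
  by rewrite ME mxE -has_count has_pred1.
case/block_levels => l [lmono ldiag].
pose rk b := s (enum_rank b); have rkK b : enum_val (s^-1%g (rk b)) = b.
  by rewrite /rk permK enum_rankK.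
exists (l \o rk); split=> [b c cb|b] /=.
  by apply: lmono; rewrite cM !rkK.
case: (ldiag (rk b)) => [[k Hk]|[M0 Hb]].
  left; exists k => m /Hk /(@expmx_gt0_sub _ _ _ (incidence f) (fun i => s^-1%g i) ME).
  by rewrite incidence_expr rkK -has_count has_pred1.
right; split; first by rewrite -{1}(rkK b) -{2}(rkK b) -cM M0.
by move=> c /Hb /perm_inj /enum_rank_inj.
Qed.

(** If some path from [b] to [c] visits a letter [d] that occurs in all its own large iterates, the
    time spent at [d] is adjustable and [c] occurs in all large iterates of [b]. Otherwise levels
    drop strictly along each path from [b] to [c], whose length is then at most [lev b]. *)
Lemma support_stable f (lev : B -> nat) :
  (forall b c, c \in f b -> (lev c <= lev b)%N) ->
  (forall b, (exists k, forall m, (k <= m)%N -> b \in mpow f m b) \/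
      b \notin f b /\ forall c, lev c = lev b -> c = b) ->
  forall b c, exists N : nat, (forall n, (N <= n)%N -> c \in mpow f n b) \/
    (forall n, (N <= n)%N -> c \notin mpow f n b).
Proof.
move=> mono diag b c.
pose rec d := exists k, forall m, (k <= m)%N -> d \in mpow f m d.
have [[d [i [j [[k Hk] db cd]]]]|nrec] :=
    pselect (exists d i j, [/\ rec d, d \in mpow f i b & c \in mpow f j d]).
  exists (j + (k + i))%N; left=> n len.
  have -> : n = (j + ((n - j - i) + i))%N.
    have le1 : (j <= n)%N := leq_trans (leq_addr _ _) len.
    have le2 : (k + i <= n - j)%N by rewrite leq_subRL.
    by rewrite subnK ?subnKC // (leq_trans (leq_addl _ _) le2).
  apply: mem_mpow_trans cd; apply: mem_mpow_trans db _; apply: Hk.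
  rewrite -subnDA leq_subRL; last first.
    by apply: leq_trans len; rewrite leq_add2l leq_addl.
  by rewrite -addnA [(i + k)%N]addnC.
exists (lev b).+1; right=> n; apply: contraL => cn.
suff dec m d j : d \in mpow f m b -> c \in mpow f j d -> (lev d + m <= lev b)%N.
  rewrite -ltnNge ltnS; apply: leq_trans (dec n c 0%N cn _); first exact: leq_addl.
  by rewrite mem_seq1.
elim: m d j => [|m IH] d j; first by rewrite mem_seq1 => /eqP->; rewrite addn0.
rewrite mpowSr => /mem_mext[e eb de] cd.
have ce : c \in mpow f (j + 1) e by apply: mem_mpow_trans cd; rewrite mpow1.
have le := IH e _ eb ce; rewrite addnS.
apply: leq_trans le; rewrite ltn_add2r ltn_neqAle mono // andbT.
case: (diag e) => [rece|[ne He]].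
  by case: nrec; exists e, m, (j + 1)%N.
by apply/eqP => /He ed; rewrite ed in de; rewrite de in ne.
Qed.

End Supports.

Lemma mext1 (A B : Type) (f : B -> seq A) b : mext f [:: b] = f b.
Proof. exact: cats0. Qed.

(** * The restricted morphisms *)

Section Restriction.
Variables (B : finType) (fp : B -> seq B) (C : {set B}).
Hypothesis closedC : forall b, b \in ~: C -> {subset fp b <= ~: C}.

Local Notation f' := (sub_morphism (mcomp (kappa (~: C)) fp) (C := C)).
Local Notation h := (sub_morphism fp (C := ~: C)).

Lemma mext_kappa (w : seq B) : mext (kappa (~: C)) w = [seq c <- w | c \in C].
Proof.
rewrite /mext; elim: w => //= c w ->; rewrite /kappa inE.
by case: (c \in C).
Qed.

Lemma sub_kappa_val b : map val (f' b) = [seq c <- fp (val b) | c \in C].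
Proof.
by rewrite sub_morphismP; [exact: mext_kappa|exact: kappa_closed].
Qed.

Lemma sub_compl_val b : map val (h b) = fp (val b).
Proof. by apply: sub_morphismP; apply: closedC; apply: valP. Qed.

Lemma mpow_compl n b : b \in ~: C -> {subset mpow fp n b <= ~: C}.
Proof.
move=> bC; elim: n => [|n IH] c; first by rewrite mem_seq1 => /eqP->.
by rewrite mpowSr => /mem_mext[d /IH dC]; apply: closedC.
Qed.

(** Letters outside [C] produce only letters outside [C], so erasing them at each step or once at
    the end leaves the same word. *)
Lemma mpow_sub_kappa n b :
  map val (mpow f' n b) = [seq c <- mpow fp n (val b) | c \in C].
Proof.
elim: n => [|n IH]; first by rewrite /= (valP b).
rewrite !mpowSr; set w := mpow f' n b in IH *.
have -> : map val (mext f' w) = mext (fun c => [seq d <- fp c | d \in C]) (map val w).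
  rewrite /mext map_flatten -!map_comp; congr flatten; apply: eq_map => c /=.
  exact: sub_kappa_val.
rewrite IH; elim: (mpow fp n (val b)) => //= c v IHv.
rewrite -[mext fp (c :: v)]/(fp c ++ mext fp v) filter_cat -IHv.
case: ifP => cC /=; first by [].
have -> // : [seq d <- fp c | d \in C] = [::].
apply/eqP; rewrite -size_eq0 size_filter -leqn0 leqNgt -has_count.
apply/hasPn => d /closedC; rewrite !inE; apply; by rewrite cC.
Qed.

Lemma mem_mpow_sub n b c :
  (c \in mpow f' n b) = (val c \in mpow fp n (val b)).
Proof.
rewrite -(mem_map val_inj) mpow_sub_kappa mem_filter.
by rewrite (valP c).
Qed.

Lemma big_sub_kappa (R : nmodType) (x : B -> R) n b :
  \sum_(c <- mpow f' n b) x (val c) = \sum_(c <- mpow fp n (val b) | c \in C) x c.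
Proof. by rewrite -(big_map val xpredT) mpow_sub_kappa big_filter. Qed.

End Restriction.

Lemma mpow_prolongable (B : Type) (f : B -> seq B) a u n :
  f a = a :: u -> (0 < n)%N -> exists v, mpow f n a = a :: v.
Proof.
move=> fa; case: n => // n _; elim: n => [|n [v IH]].
  by exists u; rewrite mpow1.
by rewrite mpowSr IH /mext /= fa; exists (u ++ flatten (map f v)).
Qed.

(** * Surviving letters and prolongability of the restricted morphism *)

Section Survivors.
Variables (A B : finType) (f : B -> seq B) (g : B -> seq A) (a : B) (p : nat).
Hypotheses (f_prol : prolongable f a) (g_inf : infinite_image g (omega_word f a)).
Hypothesis p_def : is_primitive_period (incidence f) p.

Local Notation fp := (mpow f p).
Local Notation C := (survivors f g p).
Local Notation f' := (sub_morphism (mcomp (kappa (~: C)) fp) (C := C)).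

Let p0 : (0 < p)%N. Proof. by case: p_def. Qed.

Lemma survivorsP b : reflect
  (exists N, forall n, (N <= n)%N -> mext g (mpow fp n b) <> [::]) (b \in C).
Proof.
rewrite finset.in_set.
by apply: (iffP (asboolP _)) => -[N HN]; exists N => n /HN; rewrite mpowM.
Qed.

Lemma survivors_closed b : b \in ~: C -> {subset fp b <= ~: C}.
Proof.
rewrite inE => bC c cb; rewrite inE; apply: contra bC => /survivorsP[N HN].
apply/survivorsP; exists N.+1 => -[//|n] Nn; rewrite mpowS.
have := HN n Nn; case Ew: (mext g (mpow fp n c)) => [//|l w] _ E0.
have : l \in mext g (mpow fp n c) by rewrite Ew mem_head.
case/mem_mext => d dn ld.
have : l \in mext g (mext (mpow fp n) (fp b)).
  by apply/mem_mext; exists d => //; apply/mem_mext; exists c.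
by rewrite E0.
Qed.

(** By definition such a letter is only erased by infinitely many powers; the primitivity of the
    blocks of the [p]-th power makes this permanent. Once supports are stable, a letter [c] with
    [g c] nonempty that occurs in one iterate of [b] occurs in all later ones, and [b] would
    survive. *)
Lemma mortal_eventually_erased : exists N, forall b n, b \notin C -> (N <= n)%N ->
  mext g (mpow fp n b) = [::].
Proof.
have [lev [lmono ldiag]] : exists lev : B -> nat,
    (forall b c, c \in fp b -> (lev c <= lev b)%N) /\
    forall b, (exists k, forall m, (k <= m)%N -> b \in mpow fp m b) \/
      b \notin fp b /\ forall c, lev c = lev b -> c = b.
  case: p_def => _ [s bt] _; apply: (@letter_levels _ _ s).
  rewrite (_ : incidence fp = incidence f ^+ p) //.
  by apply/matrixP => i j; rewrite incidence_expr mxE.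
have /boolp.choice[Nf HNf] : forall bc : B * B, exists N,
    (forall n, (N <= n)%N -> bc.2 \in mpow fp n bc.1) \/
    (forall n, (N <= n)%N -> bc.2 \notin mpow fp n bc.1).
  by move=> [b c]; apply: support_stable lmono ldiag b c.
exists (\max_bc Nf bc)%N => b n bC Nn.
have leN c : (Nf (b, c) <= n)%N.
  exact: leq_trans (leq_bigmax (b, c)) Nn.
apply/eqP; apply: contraNT bC => nz.
have [l ln] : exists l, l \in mext g (mpow fp n b).
  by case: (mext _ _) nz => // l w _; exists l; rewrite mem_head.
case/mem_mext: ln => c cn lc; case: (HNf (b, c)) => /= Hc; last first.
  by have := Hc n (leN c); rewrite cn.
apply/survivorsP; exists (Nf (b, c)) => m /Hc cm E.
have : l \in mext g (mpow fp m b) by apply/mem_mext; exists c.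
by rewrite E.
Qed.

Lemma mem_mpow_head n : a \in mpow f n a.
Proof.
case: n => [|n]; first by rewrite mem_seq1.
case: f_prol => -[u [_ fa]] _.
by have [v ->] := mpow_prolongable fa (ltn0Sn n); rewrite mem_head.
Qed.

Lemma image_unbounded M : exists N, forall n, (N <= n)%N ->
  (M <= size (mext g (mpow f n a)))%N.
Proof.
have [k Mk] := g_inf M; case: (f_prol) => _ /(_ k)[N HN].
exists N => n /HN kn; apply: leq_trans Mk _.
rewrite omega_wordP // /mkseq -(subnKC kn) iotaD map_cat mext_cat size_cat.
exact: leq_addr.
Qed.

Lemma image_fp_unbounded M : exists N, forall n, (N <= n)%N ->
  (M <= size (mext g (mpow fp n a)))%N.
Proof.
have [N HN] := image_unbounded M; exists N => n Nn; rewrite mpowM; apply: HN.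
by apply: leq_trans Nn _; rewrite leq_pmull.
Qed.

Lemma start_survives : a \in C.
Proof.
apply/survivorsP; have [N HN] := image_fp_unbounded 1.
by exists N => n /HN; case: (mext _ _).
Qed.

Lemma mortal_word_erased : exists N, forall w, {in w, forall c, c \notin C} ->
  forall n, (N <= n)%N -> mext g (mext (mpow fp n) w) = [::].
Proof.
have [N HN] := mortal_eventually_erased; exists N => w wC n Nn.
elim: w wC => // c w IH wC; rewrite -cat1s !mext_cat IH; last first.
  by move=> d dw; apply: wC; rewrite inE dw orbT.
by rewrite cats0 HN // wC ?mem_head.
Qed.

(** Otherwise [fp (val b)] would have only letters outside [C], all eventually erased, and [b] would
    not survive. *)
Lemma sub_nonerasing b : f' b <> [::].
Proof.
move=> fb0; have := valP b => /survivorsP[N HN].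
have [N' HN'] := mortal_word_erased.
apply: (HN (maxn N N').+1); first exact: leq_trans (leq_maxl _ _) (leqnSn _).
rewrite mpowS HN' ?leq_maxr // => c cb; apply/negP => cC.
have : c \in [seq c <- fp (val b) | c \in C] by rewrite mem_filter cC.
by rewrite -sub_kappa_val fb0.
Qed.

Lemma sub_prolongable (aC : a \in C) : prolongable f' (exist _ a aC).
Proof.
set a' := exist _ a aC.
case: (f_prol) => -[u [_ fa]] _; have [v fpa] := mpow_prolongable fa p0.
have Ef' : map val (f' a') = a :: [seq c <- v | c \in C].
  by rewrite sub_kappa_val /= fpa /= aC.
have [u' f'a vu'] : exists2 u', f' a' = a' :: u' & map val u' = [seq c <- v | c \in C].
  case: (f' a') Ef' => // c u' [ca u'v]; exists u' => //.
  by congr (_ :: _); apply: val_inj.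
(* If [u'] were empty, the tail [v] of [fp a] would eventually be erased, so the images under [g] of
   the iterates of [a] would become stationary, against [g_inf]. *)
have u'0 : u' <> [::].
  move=> u'0; have [N HN] := mortal_word_erased.
  have vC : {in v, forall c, c \notin C}.
    move=> c cv; apply/negP => cC.
    have : c \in [seq c <- v | c \in C] by rewrite mem_filter cC.
    by rewrite -vu' u'0.
  have stat n : mext g (mpow fp (N + n) a) = mext g (mpow fp N a).
    elim: n => [|n IH]; first by rewrite addn0.
    rewrite addnS mpowS fpa -cat1s !mext_cat HN ?leq_addr // cats0 -IH.
    exact: cats0.
  have [N' HN'] := image_fp_unbounded (size (mext g (mpow fp N a))).+1.
  by have := HN' (N + N')%N (leq_addl _ _); rewrite stat ltnn.
have pos n b : (0 < size (mpow f' n b))%N.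
  elim: n => // n IH; rewrite mpowSr; case: (mpow f' n b) IH => // c w _.
  rewrite -cat1s mext_cat mext1 size_cat addn_gt0.
  by have := sub_nonerasing (b := c); case: (f' c).
split; first by exists u'.
(* Each iteration appends the image of [u'], nonempty by [pos], so the length after [n] steps is at
   least [n]. *)
move=> M; exists M => n; elim: n M => [|n IH] M Mn.
  exact: leq_trans Mn _.
rewrite mpowS f'a -cat1s mext_cat mext1 size_cat.
case: u' u'0 {f'a vu'} => // c u' _.
rewrite -[c :: u']cat1s mext_cat mext1 size_cat.
case: M Mn => // M Mn; rewrite -addn1; apply: leq_add; first exact: IH.
exact: leq_trans (pos n c) (leq_addr _ _).
Qed.

Lemma omega_mem_mpow b i : omega_word f a i = b -> exists k, b \in mpow f k a.
Proof.
move=> <-; exists i; rewrite /omega_word.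
have [lt_i|le_i] := ltnP i (size (mpow f i a)); first exact: mem_nth.
by rewrite nth_default // mem_mpow_head.
Qed.

(** [f^k(a)] reappears inside [f^(pk)(a)], since [a] occurs in [f^(pk-k)(a)]. *)
Lemma mem_mpow_fp b : (exists k, b \in mpow f k a) -> exists k, b \in mpow fp k a.
Proof.
case=> k bk; exists k; rewrite mpowM -(subnK (leq_pmull k p0)) addnC.
exact: mem_mpow_trans (mem_mpow_head _) bk.
Qed.

End Survivors.

Lemma mpow_mem_omega (B : eqType) (f : B -> seq B) a b k :
  prolongable f a -> b \in mpow f k a -> exists i, omega_word f a i = b.
Proof. by move=> fa; rewrite omega_wordP // => /mapP[i _ ->]; exists i. Qed.

(** * Growth contributed by the letters outside a sub-alphabet *)

Section Complement.
Variables (R : realType) (B : finType) (fp : B -> seq B) (C : {set B}).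
Hypothesis closedC : forall b, b \in ~: C -> {subset fp b <= ~: C}.

Local Notation f' := (sub_morphism (mcomp (kappa (~: C)) fp) (C := C)).
Local Notation h := (sub_morphism fp (C := ~: C)).
Local Notation len n b := ((size (mpow fp n b))%:R : R).

(** [r] is the Perron value of the block of [fp] on the complement. If [lam <= r], then
    [eigenvalue_le_rate] forces [r = lam], and the Perron functional puts [lam] in the spectrum of
    [h]. *)
Lemma complement_gap a lam d : 1 <= lam ->
  (forall b, exists k, b \in mpow fp k a) -> theta (fun n => len n a) lam d ->
  lam%:C \notin Spec R h ->
  exists r, [/\ 0 <= r, r < lam & forall t, r < t ->
    exists y : B -> R, (forall b, 0 < y b) /\
      forall b, b \notin C -> \sum_(c <- fp b) y c <= t * y b].
Proof.
move=> lam1 acc grow nspec.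
(* The block is extended by 0 to the whole alphabet, so that [y] is positive on all letters. *)
pose M c b : R := if (b \notin C) && (c \notin C) then (count_mem c (fp b))%:R else 0.
have M0 c b : 0 <= M c b by rewrite /M; case: ifP.
have ME (x : B -> R) b : b \notin C -> \sum_c x c * M c b = \sum_(c <- fp b) x c.
  move=> bC; rewrite [RHS]sum_count; apply: eq_bigr => c _; rewrite /M bC /=.
  case: ifPn => // cC; rewrite (count_memPn _) //; apply: contra cC.
  by move/(closedC _); rewrite !finset.in_setC; apply.
have [r [r0 xr yr]] := perron_fun M0.
exists r; split=> //; last first.
  move=> t /yr[y [y0 yt]]; exists y; split=> // b bC; rewrite -ME //.
rewrite ltNge; apply/negP => ler; have rpos : 0 < r by lra.
have [x [x0 [b xb] xM]] := xr rpos.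
have bC : b \notin C.
  apply/negP => bC; move: (xM b); rewrite big1 => [/esym/eqP|c _].
    by rewrite mulf_eq0 !gt_eqF.
  by rewrite /M bC mulr0.
have bC' : b \in ~: C by rewrite finset.in_setC.
have eqr : r = lam.
  apply/eqP; rewrite eq_le ler andbT.
  apply: (@eigenvalue_le_rate _ _ _ a lam d lam1 acc grow r x b (ltW rpos)).
    elim=> [|n IH]; first by rewrite big_seq1 mul1r.
    rewrite mpowSr big_mext big_seq (eq_bigr (fun c => r * x c)) => [|c cb].
      by rewrite -big_seq -mulr_sumr IH exprS mulrA.
    rewrite -xM ME //.
    by have := mpow_compl closedC bC' cb; rewrite finset.in_setC.
  by rewrite gt_eqF.
move/negP: nspec; apply; apply/SpecP.
exists (fun c => x (val c)); split; first by exists (exist _ b bC'); rewrite gt_eqF.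
move=> c; rewrite -(big_map val xpredT) sub_compl_val // -eqr -xM ME //.
by have := valP c; rewrite finset.in_setC.
Qed.

(** The weight [s n] of the letters outside [C] satisfies [s n.+1 <= t * s n + Y * |f'^n(a)|]; as
    [t < nu], the order of the forcing term prevails. *)
Lemma len_bound_of_complement a (aC : a \in C) (y : B -> R) t nu e :
  0 <= t -> t < nu -> (forall b, 0 < y b) ->
  (forall b, b \notin C -> \sum_(c <- fp b) y c <= t * y b) ->
  (exists K, 0 < K /\ exists N, forall n, (N <= n)%N ->
     (size (mpow f' n (exist _ a aC)))%:R <= K * rate nu e n) ->
  exists L, 0 < L /\ exists N, forall n, (N <= n)%N -> len n a <= L * rate nu e n.
Proof.
move=> t0 tnu y0 yt [K [K0 [N HN]]].
set a' := exist _ a aC in HN.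
have nu0 : 0 < nu by lra.
pose s n := \sum_(c <- mpow fp n a | c \notin C) y c.
have [Y [Y0 HY]] : exists Y : R, 0 < Y /\ forall b, \sum_(c <- fp b) y c <= Y.
  exists (1 + \sum_b \sum_(c <- fp b) y c).
  have ge0 b : 0 <= \sum_(c <- fp b) y c by apply: sumr_ge0 => c _; apply: ltW.
  split=> [|b]; first by rewrite ltr_pwDl // sumr_ge0.
  by rewrite (bigD1 b) //= addrCA lerDl addr_ge0 // sumr_ge0.
have size_f' n : (size (mpow f' n a'))%:R = \sum_(c <- mpow fp n a | c \in C) (1 : R).
  rewrite -(big_sub_kappa closedC (fun=> 1) n a').
  by rewrite big_const_seq count_predT iter_addr_0.
have sS n : s n.+1 <= t * s n + Y * (size (mpow f' n a'))%:R.
  rewrite /s mpowSr size_f' !mulr_sumr.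
  have -> : \sum_(c <- mext fp (mpow fp n a) | c \notin C) y c =
      \sum_(b <- mpow fp n a) \sum_(c <- fp b | c \notin C) y c.
    by rewrite big_mkcond big_mext; apply: eq_bigr => b _; rewrite -big_mkcond.
  rewrite (bigID (fun b => b \notin C)) /=; apply: lerD.
    apply: ler_sum => b bC; apply: le_trans (yt b bC).
    rewrite [leRHS](bigID (fun c => c \notin C)) /= lerDl.
    by apply: sumr_ge0 => c _; apply: ltW.
  under eq_bigl do rewrite negbK.
  apply: ler_sum => b bC; rewrite mulr1; apply: le_trans (HY b).
  rewrite [leRHS](bigID (fun c => c \notin C)) /= lerDl.
  by apply: sumr_ge0 => c _; apply: ltW.
have w0 n : (N.+1 <= n)%N -> 0 < rate nu e n.
  by move=> Nn; rewrite rate_gt0 // (leq_trans _ Nn).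
have [|L [L0 HL]] := @le_rec_ratio _ s _ N.+1 w0.
  (* Any [L' >= Y * K / (nu - t)] satisfies [t * L' + Y * K <= nu * L'], which is what the induction
     step requires. *)
  move=> L L0; exists (Num.max L (Y * K / (nu - t))); first by rewrite le_max lexx.
  set L' := Num.max _ _ => n Nn le_s; apply: le_trans (sS n) _.
  have L'0 : 0 < L' by rewrite lt_max L0.
  have h1 : Y * K <= L' * (nu - t).
    by rewrite -ler_pdivrMr ?subr_gt0 // le_max lexx orbT.
  have h2 : Y * (size (mpow f' n a'))%:R <= Y * (K * rate nu e n).
    by rewrite ler_pM2l // HN // ltnW.
  have h3 : t * s n <= t * (L' * rate nu e n) by rewrite ler_wpM2l.
  have h4 : Y * K * rate nu e n <= L' * (nu - t) * rate nu e n.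
    by rewrite ler_wpM2r // ltW // w0.
  have h5 : L' * (nu * rate nu e n) <= L' * rate nu e n.+1.
    by rewrite ler_pM2l // rateS_ge // ltW.
  by move: h2 h3 h4 h5; set S := size _; set Q := rate nu e n; lra.
have [Z [Z0 HZ]] := len_le_sum y0.
exists (K + Z * L); split; first by rewrite addr_gt0 // mulr_gt0.
exists N.+1 => n Nn.
rewrite lenE (bigID (fun c => c \in C)) /= -size_f' mulrDl.
apply: lerD; first by apply: HN; apply: ltnW.
rewrite -mulrA; apply: (@le_trans _ _ (Z * s n)); last by rewrite ler_pM2l // HL.
rewrite /s -big_filter -[X in _ <= _ * X]big_filter.
apply: le_trans (HZ _); rewrite big_const_seq count_predT iter_addr_0.
exact: lexx.
Qed.

End Complement.

(* The functional [sum_(i < p) nu^(p-1-i) x(f^i(b))] inherits the eigenvalue. *)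
Lemma eigenfunctional_root (R : realType) (B : finType) (f : B -> seq B) p mu
    (x : B -> R) b0 :
  (0 < p)%N -> 1 <= mu -> (forall b, 0 <= x b) -> 0 < x b0 ->
  eigenfunctional (mpow f p) mu x ->
  exists nu, nu ^+ p = mu /\ nu%:C \in Spec R f.
Proof.
move=> p0 mu1 x0 xb0 xmu.
have [nu /andP[nu1 _] rt] : exists2 nu : R, 1 <= nu <= mu & root ('X^p - mu%:P) nu.
  apply: poly_ivt => //; rewrite !hornerE expr1n subr_le0 mu1 subr_ge0.
  by rewrite ler_eXnr.
have nup : nu ^+ p = mu.
  by apply/eqP; rewrite -subr_eq0; move: rt; rewrite /root !hornerE.
exists nu; split=> //; have nu0 : 0 < nu by lra.
pose S i b := \sum_(c <- mpow f i b) x c.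
have S0 i b : 0 <= S i b by apply: sumr_ge0.
pose y := fix y m b := if m is i.+1 then nu * y i b + S i b else 0.
(* A telescoping identity: at [m = p] the last two terms cancel because [nu ^+ p = mu]. *)
have yE m b : \sum_(c <- f b) y m c = nu * y m b + S m b - nu ^+ m * x b.
  elim: m => [|m IH] /=.
    by rewrite big1 // /S big_seq1; ring.
  rewrite big_split /= -mulr_sumr IH exprS.
  have -> : \sum_(c <- f b) S m c = S m.+1 b by rewrite /S mpowS big_mext.
  by ring.
have y0 m b : 0 <= y m b.
  by elim: m => //= m IH; rewrite addr_ge0 // mulr_ge0 // ltW.
have yb m : 0 < y m.+1 b0.
  elim: m => [|m IH]; first by rewrite /= mulr0 add0r /S big_seq1.
  by rewrite /= ltr_pwDl // mulr_gt0.
apply/SpecP; exists (y p); split.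
  by exists b0; case: p p0 {xmu rt nup} => // m _; rewrite gt_eqF.
by move=> b; rewrite yE /S xmu nup addrK.
Qed.

Lemma theta_mpow (R : realType) (B : Type) (f : B -> seq B) a p (lam : R) d :
  (0 < p)%N -> theta (fun n => (size (mpow f n a))%:R) lam d ->
  theta (fun n => (size (mpow (mpow f p) n a))%:R) (lam ^+ p) d.
Proof.
move=> p0 [c [C [c0 C0 [N HN]]]].
have k0 : 0 < p%:R ^+ d :> R by rewrite exprn_gt0 // ltr0n.
exists (c * p%:R ^+ d), (C * p%:R ^+ d); split; [exact: mulr_gt0|exact: mulr_gt0|].
exists N => n Nn; have := HN (p * n)%N (leq_trans Nn (leq_pmull _ p0)).
rewrite mpowM /rate natrM exprMn exprM -!mulrA; exact.
Qed.

(** * The trichotomy *)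

Theorem corollary42 (R : realType) (A B : finType) (a : B)
    (f : B -> seq B) (g : B -> seq A) (p : nat)
    (f_prol : prolongable f a)
    (g_inf : infinite_image g (omega_word f a))
    (p_def : is_primitive_period (incidence f) p) :
  let fp := mpow f p in
  let B' := survivors f g p in
  let f' := sub_morphism (mcomp (kappa (~: B')) fp) (C := B') in
  let h := sub_morphism fp (C := ~: B') in
  (forall b : B, b \in ~: B' -> {subset fp b <= ~: B'}) /\
  (forall (lam : R) (d : nat), growth_type f a lam d ->
     exactly_one3
       ((lam ^+ p)%:C \notin Spec R h /\
        sub_growth_type f' a (lam ^+ p) d)
       [/\ (lam ^+ p)%:C \in Spec R h,
           (lam ^+ p)%:C \notin Spec R f'
         & exists (lam' : R) (d' : nat),
             [/\ lam'%:C \in Spec R f, lam' < lam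
               & sub_growth_type f' a (lam' ^+ p) d']]
       [/\ (lam ^+ p)%:C \in Spec R h,
           (lam ^+ p)%:C \in Spec R f'
         & exists d' : nat,
             (d' <= d)%N /\ sub_growth_type f' a (lam ^+ p) d']).
Proof.
move=> fp B' f' h; have closed := @survivors_closed _ _ f g p.
split=> [//|lam d [lam1 _ occ grow]].
have p0 : (0 < p)%N by case: p_def.
have aB' : a \in B' := start_survives f_prol g_inf p_def.
pose a' : {b | b \in B'} := exist _ a aB'.
have prol' : prolongable f' a' := sub_prolongable f_prol g_inf p_def aB'.
set Lam := lam ^+ p; have Lam1 : 1 <= Lam by rewrite exprn_ege1.
have acc b : exists k, b \in mpow fp k a.
  have [i /(omega_mem_mpow f_prol)] := occ b.
  exact: (mem_mpow_fp f_prol p_def).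
have acc' b : exists k, b \in mpow f' k a'.
  by have [k bk] := acc (val b); exists k; rewrite (mem_mpow_sub closed).
have growp : theta (fun n => (size (mpow fp n a))%:R) Lam d by apply: theta_mpow.
(* Since [f'] is prolongable on [a'], the eventually zero alternative of [regular] is excluded. *)
have [mu [d' [mu1 grow']]] : exists mu d', 1 <= mu /\
    theta (fun n => (size (mpow f' n a'))%:R : R) mu d'.
  case: (len_regular R f' a') => // -[N HN].
  have [M HM] := prol'.2 1%N.
  have := HM (maxn N M) (leq_maxr _ _); rewrite -(ler_nat R) HN ?leq_maxl //.
  by rewrite ler10.
have grows (nu : R) e : 1 <= nu -> theta (fun n => (size (mpow f' n a'))%:R) nu e ->
    sub_growth_type f' a nu e.
  move=> nu1 th; exists aB'; split=> // b; have [k bk] := acc' b.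
  exact: mpow_mem_omega bk.
have lower_p : exists c, 0 < c /\ exists N, forall n, (N <= n)%N ->
    c * rate Lam d n <= (size (mpow fp n a))%:R.
  by case: growp => c [C [c0 _ [N HN]]]; exists c; split=> //; exists N => n /HN[].
have le_rate : rate_le mu d' Lam d.
  apply: (@theta_le_rate _ (fun n => (size (mpow f' n a'))%:R)
    (fun n => (size (mpow fp n a))%:R) _ _ _ _ 1); try by lra.
  - by case: grow' => c [C [c0 _ [N HN]]]; exists c; split=> //; exists N => n /HN[].
  - by case: growp => c [C [_ C0 [N HN]]]; exists C; split=> //; exists N => n /HN[].
  exists 0%N => n _; rewrite mul1r ler_nat -(size_map val) (mpow_sub_kappa closed).
  by rewrite size_filter count_size.
have [x [x0 [b xb] xmu]] := rate_eigenfunctional mu1 acc' grow'.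
(* [mu] is an eigenvalue of [f'] and no real eigenvalue exceeds it, while [mu <= Lam] by
   [le_rate]. *)
have spec' : Lam%:C \in Spec R f' <-> mu = Lam.
  split=> [/SpecP[y [[c yc] yLam]]|<-]; last first.
    by apply/SpecP; exists x; split=> //; exists b; rewrite gt_eqF.
  apply/eqP; rewrite eq_le; apply/andP; split; first by case: le_rate => [/ltW|[->]].
  apply: (eigenvalue_le_rate mu1 acc' grow' _ _ yc); first by lra.
  by move=> n; apply: eigenfunctional_mpow.
have [hs|hs] := boolP (Lam%:C \in Spec R h); last first.
  (* outside [B'] lengths grow more slowly, so f' carries the whole growth *)
  apply: Or31; split=> [|[]|[]] //; split=> //.
  have [r [r0 rLam gap]] := complement_gap closed Lam1 acc growp hs.
  (* For such [nu] the complement adds nothing beyond the order [(nu, d')], which therefore bounds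
     the growth of all of [fp]. *)
  have dom nu : r < nu -> mu <= nu -> rate_le Lam d nu d'.
    move=> rnu munu; have [|y [y0 yt]] := gap ((r + nu) / 2); first by lra.
    have upper : exists L, 0 < L /\ exists N, forall n, (N <= n)%N ->
        (size (mpow fp n a))%:R <= L * rate nu d' n.
      apply: (len_bound_of_complement closed _ _ y0 yt); [lra|lra|].
      case: grow' => c [C [_ C0 [N HN]]]; exists C; split=> //; exists N => n /HN[_].
      move=> le; apply: le_trans le _; rewrite ler_pM2l // /rate.
      rewrite ler_wpM2l ?exprn_ge0 //; apply: lerXn2r; rewrite ?nnegrE //; lra.
    apply: (theta_le_rate _ _ ltr01 lower_p upper); [lra|lra|].
    by exists 0%N => n _; rewrite mul1r.
  have eq_mu : mu = Lam.
    case: le_rate => [lt|[]] //.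
    (* If [mu < Lam], a [nu] strictly between [Num.max r mu] and [Lam] contradicts [dom]. *)
    pose nu := (Num.max r mu + Lam) / 2.
    have mx : Num.max r mu < Lam by rewrite gt_max rLam.
    have [m1 m2] : r <= Num.max r mu /\ mu <= Num.max r mu by rewrite !le_max !lexx orbT.
    by case: (dom nu) => [||| []]; rewrite /nu; lra.
  have eq_d : d' = d.
    apply/eqP; rewrite eqn_leq; apply/andP; split.
      by case: le_rate => [|[_]] //; rewrite eq_mu ltxx.
    (* With [mu = Lam] established, [nu = Lam] is admissible in [dom] and the comparison reduces to
       degrees. *)
    by case: (dom Lam) => [|||[_]]; rewrite ?ltxx ?eq_mu.
  by apply: grows => //; rewrite -eq_mu -eq_d.
have [eq_mu|ne_mu] := eqVneq mu Lam.
  have f's : Lam%:C \in Spec R f' by apply/spec'.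
  apply: Or33; split=> [[]|[_]|] //; first by rewrite f's.
  split=> //; exists d'; split; last by apply: grows; rewrite -?eq_mu.
  by case: le_rate => [|[_]] //; rewrite eq_mu ltxx.
have f'ns : Lam%:C \notin Spec R f'.
  by apply/negP => /spec' E; rewrite E eqxx in ne_mu.
apply: Or32; split=> [[]||[_]] //; last by rewrite (negPf f'ns).
split=> //.
(* Extension of [x] by 0 stays an eigenfunctional of [fp]: letters outside [B'] contribute nothing
   to a sum, and their own images contain only such letters. *)
pose X c := if insub c is Some c' then x c' else 0.
have Xval c : X (val c) = x c by rewrite /X valK.
have Xout c : c \notin B' -> X c = 0 by move=> cB'; rewrite /X insubN.
have Xmu : eigenfunctional fp mu X.
  move=> c; have [cB'|ncB'] := boolP (c \in B').
    have := xmu (exist _ c cB'); rewrite -Xval /= => <-.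
    rewrite (eq_bigr (fun c' => X (val c'))) => [|c' _]; last by rewrite Xval.
    rewrite -(big_map val xpredT) sub_kappa_val big_filter.
    rewrite (bigID (fun c => c \in B')) /= [X in _ + X]big1 => [|e eB'].
      by rewrite addr0.
    exact: Xout.
  rewrite (Xout _ ncB') mulr0 big_seq big1 // => e ec; apply: Xout.
  by have := closed c; rewrite finset.in_setC => /(_ ncB' _ ec); rewrite finset.in_setC.
have [||nu [nup nuS]] := @eigenfunctional_root _ _ f p mu X (val b) p0 mu1 _ _ Xmu.
- by move=> c; rewrite /X; case: insubP.
- by rewrite Xval.
exists nu, d'; split=> //; last by rewrite nup; apply: grows.
(* [lam <= nu] would give [Lam <= nu ^+ p = mu], against [mu <= Lam] and [mu != Lam]. *)
rewrite ltNge; apply/negP => le_nu.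
have : Lam <= mu.
  by rewrite -nup; apply: lerXn2r; rewrite // nnegrE; lra.
by case: le_rate => [lt|[E _]]; [rewrite leNgt lt|rewrite E eqxx in ne_mu].
Qed.
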